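(* Let $\lambda\in(0,\infty)$ and $p\in(0,1]$, and put $$r_{\lambda,p}=\frac{-2\lambda-p+\sqrt{9p^2+4\lambda p+4\lambda^2}}{4p}.$$ Then $r_{\lambda,p}<\tfrac12$, and for every analytic function $f$ on $\mathbb{D}$ with $|f(z)|<1$ for all $z\in\mathbb{D}$, $$|f(z)|^{p}+\lambda\sum_{k=1}^{\infty}\left|\frac{f^{(k)}(z)}{k!}\right||z|^{k}\leq 1\qquad\text{for all } z\text{ with } |z|=r\le r_{\lambda,p}.$$ Furthermore, the radius $r_{\lambda,p}$ is the best possible.
   Context: $\mathbb{D}=\{z\in\mathbb{C}:|z|<1\}$ is the open unit disk. The radius $r_{\lambda,p}$ being best possible means that, for the given $(p,\lambda)$, it cannot be replaced by any larger number: for every $R'$ with $r_{\lambda,p}<R'<1$ there are an analytic $f$ on $\mathbb{D}$ with $|f|<1$ on $\mathbb{D}$ and a point $z$ with $|z|\le R'$ for which the inequality fails (a divergent series of nonnegative terms is given the value $+\infty$). *)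

(* Defs.v *)
From Stdlib Require Import Reals Factorial.
From Coquelicot Require Import Coquelicot.

Open Scope R_scope.

(* Real power of a nonnegative base.  [Rpower] cannot be used at 0, where
   it takes the junk value [Rpower 0 p = 1] (as [ln 0 = 0]). *)
Definition rpow (x p : R) : R :=
  if Req_EM_T x 0 then 0 else Rpower x p.

(* Complex differentiability at every point of the open unit disk; only the
   values of [f] on the disk matter.  [ex_derive] is taken over the normed
   module of [C] over itself, not over [R]. *)
Definition analytic_on_disk (f : C -> C) : Prop :=
  forall z : C, Cmod z < 1 ->
    @ex_derive C_AbsRing C_NormedModule f z.

Definition maps_into_disk (f : C -> C) : Prop :=
  forall z : C, Cmod z < 1 -> Cmod (f z) < 1.

(* [C_derive] is a total operator; it is the complex derivative wherever the
   function is complex differentiable ([C_derive_correct]). *)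
Fixpoint C_derive_n (f : C -> C) (n : nat) (z : C) : C :=
  match n with
  | O => f z
  | S m => C_derive (C_derive_n f m) z
  end.

(* Sum of [a 1 + a 2 + ...] in the extended reals.  For nonnegative terms the
   partial sums are monotone, so this is their limit, equal to [p_infty] exactly
   when the series diverges. *)
Definition Series1_bar (a : nat -> R) : Rbar :=
  Lim_seq (fun n : nat => sum_n (fun k : nat => a (S k)) n).

Definition bohr_sum (lambda p : R) (f : C -> C) (z : C) : Rbar :=
  Rbar_plus (Finite (rpow (Cmod (f z)) p))
    (Rbar_mult (Finite lambda)
      (Series1_bar (fun k : nat =>
         Cmod (Cdiv (C_derive_n f k z) (RtoC (INR (fact k))))
         * Cmod z ^ k))).

Definition bohr_radius (lambda p : R) : R :=
  (- 2 * lambda - p + sqrt (9 * p ^ 2 + 4 * lambda * p + 4 * lambda ^ 2))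
  / (4 * p).

(* Main.v *)
Require Import Defs.
From Stdlib Require Import Reals.
From Stdlib Require Import Lra Factorial Classical ClassicalEpsilon.
From Coquelicot Require Import Coquelicot.

Open Scope R_scope.

(** Write r = |z| and t = |f(z)|. The inequality rests on the coefficient bound
    |f^(k)(z)| / k! <= 2 (1 - t) / ((1 - r^2) (1 - r)^(k-1)) for k >= 1
    ([coefficient_bound]). Multiplied by r^k and summed, the right-hand sides form
    a geometric series, convergent for r < 1/2, with sum
    2 (1 - t) r / ((1 + r) (1 - 2 r)). The radius is the positive root of a
    quadratic, and being below it means 2 lambda r <= p (1 + r) (1 - 2 r)
    ([le_bohr_radius]). So lambda times the series is at most p (1 - t), and since
    p <= 1 the concave function t^p lies below its tangent 1 - p (1 - t)
    ([rpow_le_affine], [bohr_inequality]).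

    The coefficient bound is Caratheodory's argument carried out at z. Rotate f so
    that f(z) >= 0; then Re (1 - f) >= 0. On the circle of radius rho < 1, the k-th
    Taylor coefficient at z is the mean of f against the kernel
    x / (x - z)^(k+1), while the conjugate of f and the constants have mean 0
    against it ([conj_integral_vanishes]). Hence the coefficient is minus twice the
    mean of Re (1 - f) against this kernel, whose modulus is at most a constant
    times the Poisson kernel; and the Poisson mean of Re (1 - f) is 1 - t
    ([poisson_formula]). Then rho tends to 1.

    The analytic input is Cauchy's formula for the derivatives of a function that
    is merely differentiable at each point. Goursat's bisection is done in the
    parameter square of a homotopy ([goursat]); applied to the deformation of a
    small circle about z into the circle of radius rho it gives Cauchy's formula
    ([cauchy_formula]), and differentiating under the integral sign gives the
    derivatives ([cauchy_derivatives]).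

    For sharpness take f(w) = (a - w) / (1 - a w) and z = r just above the radius:
    the series is geometric with an explicit sum ([blaschke_series]), and as a
    tends to 1 the defect 1 - |f(r)|^p and lambda times the series both vanish to
    first order in 1 - a. Comparing the leading terms is comparing
    p (1 + r) (1 - 2 r) with 2 lambda r, now in the reversed order
    ([bohr_radius_sharp]). *)

(** * Complex differentiation and curves in the plane *)

(** Cderiv and Cdiff are for maps of the complex plane, differentiated over the
    complex numbers; the other notations are for curves, functions of a real
    variable. *)
Local Notation Cderiv f z l := (@is_derive C_AbsRing C_NormedModule f z l).
Local Notation Cdiff f z := (@ex_derive C_AbsRing C_NormedModule f z).
Local Notation Rderiv f t l := (@is_derive R_AbsRing C_R_NormedModule f t l).
Local Notation Ccont f t := (@continuous R_UniformSpace C_UniformSpace f t).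
Local Notation is_CInt f a b l := (@is_RInt C_R_NormedModule f a b l).
Local Notation CInt f a b := (@RInt C_R_CompleteNormedModule f a b).

(** The plane carries two uniform structures, by modulus and by coordinates; in
    this form a local estimate is independent of the choice between them. *)
Lemma Cderiv_eps (f : C -> C) (z l : C) :
  Cderiv f z l <->
  forall eps, 0 < eps -> exists delta, 0 < delta /\ forall w,
    Cmod (w - z) < delta ->
    Cmod (f w - f z - (w - z) * l) <= eps * Cmod (w - z).
Proof.
  split.
  - intros [_ H] eps Heps.
    destruct (H z (fun P HP => HP) (mkposreal eps Heps)) as [d Hd].
    exists d; split; [apply d | intros w Hw]. exact (Hd w Hw).
  - intros H; split.
    + apply (is_linear_scal_l (K := C_AbsRing) (V := C_NormedModule)).
    + intros x Hx.
      assert (E : z = x)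
        by exact (@is_filter_lim_locally_unique C_AbsRing (AbsRing_NormedModule C_AbsRing) z x Hx).
      subst x. intros eps.
      destruct (H eps (cond_pos eps)) as [d [d0 Hd]].
      exists (mkposreal d d0). intros w Hw. exact (Hd w Hw).
Qed.

Lemma Cnorm_Cmod (z : C) : @norm R_AbsRing C_R_NormedModule z = Cmod z.
Proof. symmetry; apply Cmod_norm. Qed.

Lemma Rderiv_eps (f : R -> C) (t : R) (l : C) :
  Rderiv f t l <->
  forall eps, 0 < eps -> exists delta, 0 < delta /\ forall s,
    Rabs (s - t) < delta ->
    Cmod (f s - f t - RtoC (s - t) * l) <= eps * Rabs (s - t).
Proof.
  split.
  - intros [_ H] eps Heps.
    destruct (H t (fun P HP => HP) (mkposreal eps Heps)) as [d Hd].
    exists d; split; [apply d | intros w Hw].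
    rewrite <- scal_R_Cmult.
    specialize (Hd w Hw).
    rewrite <- Cnorm_Cmod. exact Hd.
  - intros H; split.
    + apply (is_linear_scal_l (K := R_AbsRing) (V := C_R_NormedModule)).
    + intros x Hx.
      assert (E : t = x)
        by exact (@is_filter_lim_locally_unique R_AbsRing (AbsRing_NormedModule R_AbsRing) t x Hx).
      subst x. intros eps.
      destruct (H eps (cond_pos eps)) as [d [d0 Hd]].
      exists (mkposreal d d0). intros w Hw.
      specialize (Hd w Hw). rewrite <- scal_R_Cmult in Hd.
      rewrite <- Cnorm_Cmod in Hd. exact Hd.
Qed.

Lemma Cmod_le_Re_Im (z : C) : Cmod z <= Rabs (Re z) + Rabs (Im z).
Proof.
  replace z with (RtoC (Re z) + Ci * RtoC (Im z))%C at 1.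
  - eapply Rle_trans; [apply Cmod_triangle|].
    rewrite Cmod_mult, Cmod_Ci, !Cmod_R. lra.
  - destruct z; unfold RtoC, Ci, Cmult, Cplus; simpl. f_equal; ring.
Qed.

Lemma im_le_Cmod (z : C) : Rabs (Im z) <= Cmod z.
Proof.
  eapply Rle_trans; [|apply Rmax_Cmod]. apply Rmax_r.
Qed.

Lemma Cmod_minus_ge (a b : C) : Cmod a - Cmod b <= Cmod (a - b).
Proof.
  assert (T := Cmod_triangle (a - b) b). replace (a - b + b)%C with a in T by ring. lra.
Qed.

Lemma RtoC_neq_0 (x : R) : x <> 0 -> RtoC x <> 0%C.
Proof. intros H E. apply H. injection E. auto. Qed.

Lemma Cconj_neq_0 (z : C) : z <> 0%C -> Cconj z <> 0%C.
Proof. intros H. apply Cmod_gt_0. rewrite Cmod_conj. apply Cmod_gt_0, H. Qed.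

Lemma Ccont_eps (f : R -> C) (t : R) :
  Ccont f t <->
  forall eps, 0 < eps -> exists delta, 0 < delta /\ forall s,
    Rabs (s - t) < delta -> Cmod (f s - f t) < eps.
Proof.
  split.
  - intros H eps Heps.
    assert (He : 0 < eps / 2) by lra.
    destruct (H (ball (f t) (mkposreal _ He))) as [d Hd].
    { exists (mkposreal _ He); auto. }
    exists d; split; [apply d | intros s Hs].
    destruct (Hd s Hs) as [B1 B2].
    eapply Rle_lt_trans; [apply Cmod_le_Re_Im|].
    change (Rabs (Re (f s) - Re (f t)) < eps / 2) in B1.
    change (Rabs (Im (f s) - Im (f t)) < eps / 2) in B2.
    change (Rabs (Re (f s) - Re (f t)) + Rabs (Im (f s) - Im (f t)) < eps). lra.
  - intros H P [eps HP].
    destruct (H eps (cond_pos eps)) as [d [d0 Hd]].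
    exists (mkposreal d d0). intros s Hs. apply HP.
    specialize (Hd s Hs). split.
    + change (Rabs (Re (f s - f t)) < eps). eapply Rle_lt_trans; [apply re_le_Cmod|auto].
    + change (Rabs (Im (f s - f t)) < eps). eapply Rle_lt_trans; [apply im_le_Cmod|auto].
Qed.

Lemma Cdiff_cont_eps (f : C -> C) (z : C) : Cdiff f z ->
  forall eps, 0 < eps -> exists delta, 0 < delta /\ forall w,
    Cmod (w - z) < delta -> Cmod (f w - f z) < eps.
Proof.
  intros [l Hl] eps He.
  destruct (proj1 (Cderiv_eps f z l) Hl 1 Rlt_0_1) as [d [d0 Hd]].
  assert (Hm := Cmod_ge_0 l).
  exists (Rmin d (eps / (2 + Cmod l))). split.
  - apply Rmin_pos; auto. apply Rdiv_lt_0_compat; lra.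
  - intros w Hw.
    assert (H1 := Rlt_le_trans _ _ _ Hw (Rmin_l _ _)).
    assert (H2 := Rlt_le_trans _ _ _ Hw (Rmin_r _ _)).
    specialize (Hd w H1).
    replace (f w - f z)%C with ((f w - f z - (w - z) * l) + (w - z) * l)%C by ring.
    eapply Rle_lt_trans; [apply Cmod_triangle|]. rewrite Cmod_mult.
    assert (H3 : Cmod (w - z) * (2 + Cmod l) < eps).
    { apply (Rmult_lt_compat_r (2 + Cmod l)) in H2; [|lra].
      unfold Rdiv in H2. rewrite Rmult_assoc, Rinv_l in H2; lra. }
    assert (H4 := Cmod_ge_0 (w - z)). nra.
Qed.

Lemma Ccont_comp (F : C -> C) (g : R -> C) (t : R) :
  Cdiff F (g t) -> Ccont g t -> Ccont (fun s => F (g s)) t.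
Proof.
  intros HF Hg. apply Ccont_eps. intros eps He.
  destruct (Cdiff_cont_eps F (g t) HF eps He) as [d [d0 Hd]].
  destruct (proj1 (Ccont_eps g t) Hg d d0) as [d' [d0' Hd']].
  exists d'; split; auto.
Qed.

Lemma Ccont_mult (f g : R -> C) (t : R) :
  Ccont f t -> Ccont g t -> Ccont (fun s => (f s * g s)%C) t.
Proof.
  intros Hf Hg. apply Ccont_eps. intros eps He.
  assert (Hf0 := Cmod_ge_0 (f t)). assert (Hg0 := Cmod_ge_0 (g t)).
  set (M := 1 + Cmod (f t) + Cmod (g t)).
  assert (HM : 0 < M) by (unfold M; lra).
  assert (He' : 0 < Rmin 1 (eps / M)).
  { apply Rmin_pos; [lra|]. apply Rdiv_lt_0_compat; lra. }
  destruct (proj1 (Ccont_eps f t) Hf _ He') as [d [d0 Hd]].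
  destruct (proj1 (Ccont_eps g t) Hg _ He') as [d' [d0' Hd']].
  exists (Rmin d d'); split; [apply Rmin_pos; auto|].
  intros s Hs.
  specialize (Hd s (Rlt_le_trans _ _ _ Hs (Rmin_l _ _))).
  specialize (Hd' s (Rlt_le_trans _ _ _ Hs (Rmin_r _ _))).
  replace (f s * g s - f t * g t)%C with
    ((f s - f t) * (g s - g t) + (f s - f t) * g t + f t * (g s - g t))%C by ring.
  eapply Rle_lt_trans; [apply Cmod_triangle|].
  eapply Rle_lt_trans; [apply Rplus_le_compat_r, Cmod_triangle|].
  rewrite !Cmod_mult.
  assert (A1 := Rmin_l 1 (eps / M)). assert (A2 := Rmin_r 1 (eps / M)).
  assert (A3 : eps / M * M = eps) by (field; lra).
  assert (B1 := Cmod_ge_0 (f s - f t)). assert (B2 := Cmod_ge_0 (g s - g t)).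
  set (m := Rmin 1 (eps / M)) in *.
  assert (Cmod (f s - f t) * Cmod (g s - g t) < 1 * m).
  { apply Rmult_le_0_lt_compat; lra. }
  assert (Cmod (f s - f t) * Cmod (g t) <= m * Cmod (g t)).
  { apply Rmult_le_compat_r; lra. }
  assert (Cmod (f t) * Cmod (g s - g t) <= Cmod (f t) * m).
  { apply Rmult_le_compat_l; lra. }
  assert (m * M <= eps). { rewrite <- A3. apply Rmult_le_compat_r; lra. }
  unfold M in *. nra.
Qed.

Lemma Ccont_const (c : C) (t : R) : Ccont (fun _ => c) t.
Proof. apply continuous_const. Qed.

Lemma Ccont_plus (f g : R -> C) (t : R) : Ccont f t -> Ccont g t -> Ccont (fun s => f s + g s)%C t.
Proof. exact (continuous_plus (V := C_R_NormedModule) f g t). Qed.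

Lemma Ccont_pow (f : R -> C) (k : nat) (t : R) : Ccont f t -> Ccont (fun s => f s ^ k)%C t.
Proof.
  intros H. induction k as [|k IH]; simpl.
  - apply Ccont_const.
  - apply Ccont_mult; auto.
Qed.

Lemma Rderiv_Ccont (f : R -> C) (t : R) (l : C) : Rderiv f t l -> Ccont f t.
Proof.
  intros H. apply (ex_derive_continuous (K := R_AbsRing) (V := C_R_NormedModule) f t).
  exists l; exact H.
Qed.

Lemma Rderiv_ext (f g : R -> C) (t : R) (l : C) :
  (forall s, f s = g s) -> Rderiv f t l -> Rderiv g t l.
Proof. exact (is_derive_ext (K := R_AbsRing) (V := C_R_NormedModule) f g t l). Qed.

Lemma Rderiv_pair (f : R -> C) (t : R) (l : C) :
  is_derive (fun s => Re (f s)) t (Re l) ->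
  is_derive (fun s => Im (f s)) t (Im l) -> Rderiv f t l.
Proof.
  intros [_ H1] [_ H2]. apply Rderiv_eps. intros eps He.
  assert (He2 : 0 < eps / 2) by lra.
  destruct (H1 t (fun P HP => HP) (mkposreal _ He2)) as [d1 D1].
  destruct (H2 t (fun P HP => HP) (mkposreal _ He2)) as [d2 D2].
  exists (Rmin d1 d2). split; [apply Rmin_pos; [apply d1|apply d2]|].
  intros s Hs.
  specialize (D1 s (Rlt_le_trans _ _ _ Hs (Rmin_l _ _))).
  specialize (D2 s (Rlt_le_trans _ _ _ Hs (Rmin_r _ _))).
  change (Rabs (Re (f s) - Re (f t) - (s - t) * Re l) <= eps / 2 * Rabs (s - t)) in D1.
  change (Rabs (Im (f s) - Im (f t) - (s - t) * Im l) <= eps / 2 * Rabs (s - t)) in D2.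
  eapply Rle_trans; [apply Cmod_le_Re_Im|].
  replace (Re (f s - f t - RtoC (s - t) * l)) with (Re (f s) - Re (f t) - (s - t) * Re l)
    by (unfold Re, Cminus, Cplus, Copp, Cmult, RtoC; simpl; ring).
  replace (Im (f s - f t - RtoC (s - t) * l)) with (Im (f s) - Im (f t) - (s - t) * Im l)
    by (unfold Im, Cminus, Cplus, Copp, Cmult, RtoC; simpl; ring).
  lra.
Qed.

Lemma Rderiv_affine (a b : C) (t : R) : Rderiv (fun s => a + RtoC s * b)%C t b.
Proof.
  apply Rderiv_eps. intros eps He. exists 1; split; [lra|]. intros s _.
  replace (a + RtoC s * b - (a + RtoC t * b) - RtoC (s - t) * b)%C with (RtoC 0).
  - rewrite Cmod_0. apply Rmult_le_pos; [lra|apply Rabs_pos].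
  - rewrite RtoC_minus. ring.
Qed.

(** The chain rule across two scalar fields: the outer map is complex
    differentiable, the inner one is a curve. *)
Lemma Rderiv_comp (G : C -> C) (g : R -> C) (t : R) (l d : C) :
  Cderiv G (g t) l -> Rderiv g t d -> Rderiv (fun s => G (g s)) t (l * d)%C.
Proof.
  intros HG Hg. apply Rderiv_eps. intros eps He.
  assert (Hl := Cmod_ge_0 l). assert (Hd := Cmod_ge_0 d).
  set (e2 := Rmin 1 (eps / (2 * (1 + Cmod l)))).
  assert (E2 : 0 < e2).
  { apply Rmin_pos; [lra|]. apply Rdiv_lt_0_compat; lra. }
  set (e1 := eps / (2 * (1 + Cmod d))).
  assert (E1 : 0 < e1) by (apply Rdiv_lt_0_compat; lra).
  destruct (proj1 (Cderiv_eps G (g t) l) HG e1 E1) as [d1 [d10 D1]].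
  destruct (proj1 (Rderiv_eps g t d) Hg e2 E2) as [d2 [d20 D2]].
  destruct (proj1 (Ccont_eps g t) (Rderiv_Ccont g t d Hg) d1 d10) as [d3 [d30 D3]].
  exists (Rmin d2 d3). split; [apply Rmin_pos; auto|].
  intros s Hs.
  specialize (D2 s (Rlt_le_trans _ _ _ Hs (Rmin_l _ _))).
  specialize (D3 s (Rlt_le_trans _ _ _ Hs (Rmin_r _ _))).
  specialize (D1 _ D3).
  assert (F1 : e2 * (1 + Cmod l) <= eps / 2).
  { apply Rle_trans with (eps / (2 * (1 + Cmod l)) * (1 + Cmod l)).
    - apply Rmult_le_compat_r; [lra|apply Rmin_r].
    - right; field; lra. }
  assert (F2 : e1 * (1 + Cmod d) = eps / 2) by (unfold e1; field; lra).
  assert (F3 : e2 <= 1) by apply Rmin_l.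
  assert (Hs0 := Rabs_pos (s - t)).
  assert (D4 : Cmod (g s - g t) <= (1 + Cmod d) * Rabs (s - t)).
  { replace (g s - g t)%C with ((g s - g t - RtoC (s - t) * d) + RtoC (s - t) * d)%C by ring.
    eapply Rle_trans; [apply Cmod_triangle|]. rewrite Cmod_mult, Cmod_R.
    assert (e2 * Rabs (s - t) <= 1 * Rabs (s - t)) by (apply Rmult_le_compat_r; lra). nra. }
  replace (G (g s) - G (g t) - RtoC (s - t) * (l * d))%C with
    ((G (g s) - G (g t) - (g s - g t) * l) + l * (g s - g t - RtoC (s - t) * d))%C by ring.
  eapply Rle_trans; [apply Cmod_triangle|]. rewrite Cmod_mult.
  apply Rle_trans with (eps / 2 * Rabs (s - t) + eps / 2 * Rabs (s - t)); [|lra].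
  apply Rplus_le_compat.
  - rewrite <- F2. eapply Rle_trans; [exact D1|]. rewrite Rmult_assoc.
    apply Rmult_le_compat_l; lra.
  - apply Rle_trans with (Cmod l * (e2 * Rabs (s - t))).
    + apply Rmult_le_compat_l; lra.
    + rewrite <- Rmult_assoc. apply Rmult_le_compat_r; [lra|]. nra.
Qed.

(** The plane carries two normed-module structures over itself, with different
    underlying uniform spaces; this transports the product and chain rules. *)
Lemma Cderiv_ring (f : C -> C) (z l : C) :
  Cderiv f z l <-> @is_derive C_AbsRing (AbsRing_NormedModule C_AbsRing) f z l.
Proof.
  split; intros [[H1 H2 H3] H]; (split; [split; [exact H1|exact H2|exact H3]|exact H]).
Qed.

Lemma Cderiv_mult (f g : C -> C) (z l m : C) :
  Cderiv f z l -> Cderiv g z m ->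
  Cderiv (fun w => f w * g w)%C z (l * g z + f z * m)%C.
Proof.
  rewrite !Cderiv_ring. intros Hf Hg.
  exact (is_derive_mult (K := C_AbsRing) f g z l m Hf Hg Cmult_comm).
Qed.

Lemma Cderiv_plus (f g : C -> C) (z l m : C) :
  Cderiv f z l -> Cderiv g z m -> Cderiv (fun w => f w + g w)%C z (l + m)%C.
Proof.
  exact (is_derive_plus (K := C_AbsRing) (V := C_NormedModule) f g z l m).
Qed.

Lemma Cderiv_id (z : C) : Cderiv (fun w => w) z (RtoC 1).
Proof. apply Cderiv_ring. exact (is_derive_id (K := C_AbsRing) z). Qed.

Lemma Cderiv_const (c z : C) : Cderiv (fun _ => c) z (RtoC 0).
Proof. exact (is_derive_const (K := C_AbsRing) (V := C_NormedModule) c z). Qed.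

Lemma Cderiv_affine (a b z : C) : Cderiv (fun w => a + b * w)%C z b.
Proof.
  apply Cderiv_eps. intros eps He. exists 1; split; [lra|]. intros s _.
  replace (a + b * s - (a + b * z) - (s - z) * b)%C with (RtoC 0) by ring.
  rewrite Cmod_0. apply Rmult_le_pos; [lra|apply Cmod_ge_0].
Qed.

Lemma Cderiv_inv (z : C) : z <> 0%C -> Cderiv (fun w => / w)%C z (- / (z * z))%C.
Proof.
  intros Hz. apply Cderiv_eps. intros eps He.
  assert (Hm : 0 < Cmod z) by (apply Cmod_gt_0; auto).
  exists (Rmin (Cmod z / 2) (eps * (Cmod z ^ 3) / 2)).
  assert (H3 : 0 < Cmod z ^ 3) by (apply pow_lt; auto).
  split; [apply Rmin_pos; nra|]. intros w Hw.
  assert (H1 := Rlt_le_trans _ _ _ Hw (Rmin_l _ _)).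
  assert (H2 := Rlt_le_trans _ _ _ Hw (Rmin_r _ _)).
  assert (Hw2 : Cmod z / 2 <= Cmod w).
  { assert (T := Cmod_triangle w (z - w)).
    replace (w + (z - w))%C with z in T by ring.
    replace (z - w)%C with (- (w - z))%C in T by ring.
    rewrite Cmod_opp in T. lra. }
  assert (Hw0 : w <> 0%C) by (apply Cmod_gt_0; lra).
  replace (/ w - / z - (w - z) * - / (z * z))%C with ((w - z) * ((w - z) * / (w * (z * z))))%C
    by (field; auto).
  rewrite Cmod_mult, Rmult_comm. apply Rmult_le_compat_r; [apply Cmod_ge_0|].
  rewrite Cmod_mult, Cmod_inv, !Cmod_mult
    by (apply Cmult_neq_0; auto; apply Cmult_neq_0; auto).
  assert (P : 0 < Cmod w * (Cmod z * Cmod z)) by (apply Rmult_lt_0_compat; nra).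
  apply (Rmult_le_reg_r _ _ _ P). rewrite Rmult_assoc, Rinv_l, Rmult_1_r by lra.
  assert (Cmod z / 2 * (Cmod z * Cmod z) <= Cmod w * (Cmod z * Cmod z)).
  { apply Rmult_le_compat_r; nra. }
  assert (eps * (Cmod z / 2 * (Cmod z * Cmod z)) <= eps * (Cmod w * (Cmod z * Cmod z)))
    by (apply Rmult_le_compat_l; lra).
  simpl in H2. nra.
Qed.

Lemma Cderiv_comp (f g : C -> C) (z l m : C) :
  Cderiv f (g z) l -> Cderiv g z m -> Cderiv (fun w => f (g w)) z (m * l)%C.
Proof.
  rewrite (Cderiv_ring g). exact (is_derive_comp (K := C_AbsRing) (V := C_NormedModule) f g z l m).
Qed.

Lemma Cderiv_ext_loc (f g : C -> C) (z l : C) (d : R) : 0 < d ->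
  (forall w, Cmod (w - z) < d -> f w = g w) -> Cderiv f z l -> Cderiv g z l.
Proof.
  intros d0 H. apply (is_derive_ext_loc (K := C_AbsRing) (V := C_NormedModule)).
  exists (mkposreal d d0). intros w Hw. apply H. exact Hw.
Qed.

Lemma Cdiff_const (c z : C) : Cdiff (fun _ => c) z.
Proof. eexists. apply Cderiv_const. Qed.

Lemma Cdiff_id (z : C) : Cdiff (fun w => w) z.
Proof. eexists. apply Cderiv_id. Qed.

Lemma Cdiff_affine (a b z : C) : Cdiff (fun w => a + b * w)%C z.
Proof. eexists. apply Cderiv_affine. Qed.

Lemma Cdiff_ext (f g : C -> C) (z : C) : (forall w, f w = g w) -> Cdiff f z -> Cdiff g z.
Proof.
  intros H [l Hl]. exists l. apply (Cderiv_ext_loc f g z l 1); auto. lra.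
Qed.

Lemma Cdiff_mult (f g : C -> C) (z : C) : Cdiff f z -> Cdiff g z -> Cdiff (fun w => f w * g w)%C z.
Proof. intros [l Hl] [m Hm]. eexists. apply Cderiv_mult; eauto. Qed.

Lemma Cdiff_pow (f : C -> C) (k : nat) (z : C) : Cdiff f z -> Cdiff (fun w => f w ^ k)%C z.
Proof.
  intros H. induction k as [|k IH]; simpl.
  - eexists. apply Cderiv_const.
  - apply Cdiff_mult; auto.
Qed.

Lemma Cdiff_inv (f : C -> C) (z : C) : Cdiff f z -> f z <> 0%C -> Cdiff (fun w => / f w)%C z.
Proof.
  intros [l Hl] Hz. eexists. apply (Cderiv_comp (fun w => / w)%C f); eauto.
  apply Cderiv_inv; auto.
Qed.

Lemma Cdiff_shift_inv (z w : C) : w <> z -> Cdiff (fun w => / (w - z))%C w.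
Proof.
  intros H. apply (Cdiff_ext (fun w => / (- z + 1 * w))%C).
  - intros u. f_equal. ring.
  - apply (Cdiff_inv (fun w => - z + 1 * w)%C); [apply Cdiff_affine|].
    intros E. apply H. apply Ceq_minus. rewrite <- E. ring.
Qed.

(** * Integrals of complex-valued functions *)

Lemma CInt_correct (f : R -> C) (a b : R) : a <= b ->
  (forall t, a <= t <= b -> Ccont f t) -> is_CInt f a b (CInt f a b).
Proof.
  intros Hab Hf. apply (RInt_correct (V := C_R_CompleteNormedModule)).
  apply (ex_RInt_continuous (V := C_R_CompleteNormedModule)).
  intros t Ht. rewrite Rmin_left, Rmax_right in Ht by lra. exact (Hf t Ht).
Qed.

Lemma is_CInt_unique (f : R -> C) (a b : R) (l : C) : is_CInt f a b l -> CInt f a b = l.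
Proof. exact (is_RInt_unique (V := C_R_CompleteNormedModule) f a b l). Qed.

Lemma is_CInt_minus (f g : R -> C) (a b : R) (l m : C) : is_CInt f a b l -> is_CInt g a b m ->
  is_CInt (fun t => f t - g t)%C a b (l - m)%C.
Proof. exact (is_RInt_minus (V := C_R_NormedModule) f g a b l m). Qed.

Lemma is_CInt_plus (f g : R -> C) (a b : R) (l m : C) : is_CInt f a b l -> is_CInt g a b m ->
  is_CInt (fun t => f t + g t)%C a b (l + m)%C.
Proof. exact (is_RInt_plus (V := C_R_NormedModule) f g a b l m). Qed.

Lemma is_CInt_ext (f g : R -> C) (a b : R) (l : C) : a <= b ->
  (forall t, a <= t <= b -> f t = g t) -> is_CInt f a b l -> is_CInt g a b l.
Proof.
  intros Hab H. apply (is_RInt_ext (V := C_R_NormedModule)).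
  intros t Ht. rewrite Rmin_left, Rmax_right in Ht by lra. apply H; lra.
Qed.

Lemma is_CInt_Re (f : R -> C) (a b : R) (l : C) :
  is_CInt f a b l -> is_RInt (fun t => Re (f t)) a b (Re l).
Proof.
  exact (is_RInt_fct_extend_fst (U := R_NormedModule) (V := R_NormedModule) f a b l).
Qed.

Lemma is_CInt_Im (f : R -> C) (a b : R) (l : C) :
  is_CInt f a b l -> is_RInt (fun t => Im (f t)) a b (Im l).
Proof.
  exact (is_RInt_fct_extend_snd (U := R_NormedModule) (V := R_NormedModule) f a b l).
Qed.

Lemma is_CInt_pair (f : R -> C) (a b : R) (l : C) :
  is_RInt (fun t => Re (f t)) a b (Re l) -> is_RInt (fun t => Im (f t)) a b (Im l) ->
  is_CInt f a b l.
Proof.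
  destruct l as [x y].
  exact (is_RInt_fct_extend_pair (U := R_NormedModule) (V := R_NormedModule) f a b x y).
Qed.

Lemma is_CInt_scal (k : C) (f : R -> C) (a b : R) (l : C) :
  is_CInt f a b l -> is_CInt (fun t => k * f t)%C a b (k * l)%C.
Proof.
  intros H. assert (H1 := is_CInt_Re _ _ _ _ H). assert (H2 := is_CInt_Im _ _ _ _ H).
  apply is_CInt_pair.
  - apply (is_RInt_ext (fun t => minus (scal (Re k) (Re (f t))) (scal (Im k) (Im (f t))))).
    + intros t _. rewrite re_mult. reflexivity.
    + rewrite re_mult. apply (is_RInt_minus (V := R_NormedModule)); apply (is_RInt_scal (V := R_NormedModule)); auto.
  - apply (is_RInt_ext (fun t => plus (scal (Re k) (Im (f t))) (scal (Im k) (Re (f t))))).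
    + intros t _. rewrite im_mult. reflexivity.
    + rewrite im_mult. apply (is_RInt_plus (V := R_NormedModule)); apply (is_RInt_scal (V := R_NormedModule)); auto.
Qed.

Lemma is_CInt_conj (f : R -> C) (a b : R) (l : C) :
  is_CInt f a b l -> is_CInt (fun t => Cconj (f t)) a b (Cconj l).
Proof.
  intros H. assert (H1 := is_CInt_Re _ _ _ _ H). assert (H2 := is_CInt_Im _ _ _ _ H).
  apply is_CInt_pair; [exact H1|].
  exact (is_RInt_opp (V := R_NormedModule) _ _ _ _ H2).
Qed.

Lemma is_CInt_const (c : C) : is_CInt (fun _ => c) 0 1 c.
Proof.
  assert (H := is_RInt_const (V := C_R_NormedModule) 0 1 c).
  assert (E : @scal R_Ring C_R_ModuleSpace (1 - 0) c = c).
  { rewrite scal_R_Cmult. replace (1 - 0) with 1 by ring. apply Cmult_1_l. }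
  change (is_CInt (fun _ => c) 0 1 (@scal R_Ring C_R_ModuleSpace (1 - 0) c)) in H.
  rewrite E in H. exact H.
Qed.

Lemma CInt_bound (f : R -> C) (a b : R) (l : C) (M : R) : a <= b ->
  (forall t, a <= t <= b -> Cmod (f t) <= M) -> is_CInt f a b l -> Cmod l <= (b - a) * M.
Proof.
  intros Hab HM Hl. rewrite <- Cnorm_Cmod.
  apply (norm_RInt_le_const (V := C_R_NormedModule) f a b l M Hab); [|exact Hl].
  intros t Ht. rewrite Cnorm_Cmod. auto.
Qed.

Lemma CInt_derive (f df : R -> C) (a b : R) : a <= b ->
  (forall t, a <= t <= b -> Rderiv f t (df t)) ->
  (forall t, a <= t <= b -> Ccont df t) -> is_CInt df a b (f b - f a)%C.
Proof.
  intros Hab H1 H2.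
  apply (is_RInt_derive (V := C_R_CompleteNormedModule) f df a b);
  intros t Ht; rewrite Rmin_left, Rmax_right in Ht by lra; [exact (H1 t Ht)|exact (H2 t Ht)].
Qed.

Lemma CInt_split (f : R -> C) (a b c : R) : a <= b -> b <= c ->
  (forall t, a <= t <= c -> Ccont f t) -> CInt f a c = (CInt f a b + CInt f b c)%C.
Proof.
  intros Hab Hbc Hf. apply is_CInt_unique.
  apply (is_RInt_Chasles (V := C_R_NormedModule) f a b c);
  apply CInt_correct; auto; intros t Ht; apply Hf; lra.
Qed.

Lemma mean_value_bound (f df : R -> C) (K a b : R) : a <= b ->
  (forall t, Rderiv f t (df t)) -> (forall t, Ccont df t) -> (forall t, Cmod (df t) <= K) ->
  Cmod (f b - f a) <= K * (b - a).
Proof.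
  intros Hab H1 H2 H3. rewrite Rmult_comm.
  eapply CInt_bound; [exact Hab| |apply (CInt_derive f df)]; auto.
Qed.

(** * Goursat's theorem on a parametrised square *)

Lemma nested_intervals (a b : nat -> R) :
  (forall n, a n <= a (S n)) -> (forall n, b (S n) <= b n) ->
  (forall n, a n <= b n) -> exists u, forall n, a n <= u <= b n.
Proof.
  intros Ha Hb Hab.
  assert (A : forall n m, (n <= m)%nat -> a n <= a m).
  { intros n m L; induction L; [lra|]. specialize (Ha m). lra. }
  assert (B : forall n m, (n <= m)%nat -> b m <= b n).
  { intros n m L; induction L; [lra|]. specialize (Hb m). lra. }
  assert (AB : forall n m, a n <= b m).
  { intros n m. destruct (Nat.le_ge_cases n m) as [L|L].
    - specialize (A n m L). specialize (Hab m). lra.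
    - specialize (B m n L). specialize (Hab n). lra. }
  destruct (completeness (fun x => exists n, x = a n)) as [u [U1 U2]].
  - exists (b 0%nat). intros x [n ->]. apply AB.
  - exists (a 0%nat), 0%nat. reflexivity.
  - exists u. intros n. split.
    + apply U1. exists n; reflexivity.
    + apply U2. intros x [m ->]. apply AB.
Qed.

(** Cousin's lemma for squares with dyadic corners. The radius of validity at a
    point is allowed to depend on that point without any uniformity, which is what
    differentiability at each point provides. *)
Lemma dyadic_square_induction (P : R -> R -> R -> Prop) :
  (forall x y h, 0 < h -> 0 <= x -> x + (h + h) <= 1 -> 0 <= y -> y + (h + h) <= 1 ->
     P x y h -> P (x + h) y h -> P x (y + h) h -> P (x + h) (y + h) h ->
     P x y (h + h)) ->
  (forall u v, 0 <= u <= 1 -> 0 <= v <= 1 ->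
     exists delta, 0 < delta /\ forall x y h, 0 < h < delta ->
       0 <= x <= u -> u <= x + h <= 1 -> 0 <= y <= v -> v <= y + h <= 1 ->
       P x y h) ->
  P 0 0 1.
Proof.
  intros Hquad Hloc. apply NNPP. intros Hn.
  pose (X := fun p : R * R * R => fst (fst p)).
  pose (Y := fun p : R * R * R => snd (fst p)).
  pose (L := fun p : R * R * R => snd p).
  pose (bad := fun p => (0 < L p /\ 0 <= X p /\ X p + L p <= 1 /\ 0 <= Y p /\ Y p + L p <= 1)
                        /\ ~ P (X p) (Y p) (L p)).
  pose (child := fun p q => L q = L p / 2 /\ X p <= X q <= X p + L p / 2
                            /\ Y p <= Y q <= Y p + L p / 2).
  assert (Hstep : forall p, bad p -> exists q, bad q /\ child p q).
  { intros [[x y] h]. unfold bad, child, X, Y, L; simpl. intros [[h0 [x0 [x1 [y0 y1]]]] Hp].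
    apply NNPP. intros Hc. apply Hp.
    replace h with (h / 2 + h / 2) by lra.
    assert (Q : forall x' y', x <= x' <= x + h / 2 -> y <= y' <= y + h / 2 -> P x' y' (h / 2)).
    { intros x' y' Hx Hy. apply NNPP. intros Hq. apply Hc.
      exists (x', y', h / 2). simpl. repeat split; try assumption; try lra. }
    apply Hquad; try lra; apply Q; lra. }
  (* A bad square has a bad quarter; iterating the choice of one gives nested
     squares that shrink to a point, where the local hypothesis applies. *)
  pose (next := fun p => epsilon (inhabits p) (fun q => bad q /\ child p q)).
  pose (s := fun n => Nat.iter n next ((0, 0), 1)).
  assert (Hs : forall n, bad (s n)).
  { induction n as [|n IH].
    - unfold bad, X, Y, L; simpl. split; [lra|exact Hn].
    - apply (epsilon_spec (inhabits (s n)) _ (Hstep _ IH)). }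
  assert (Hc : forall n, child (s n) (s (S n))).
  { intros n. apply (epsilon_spec (inhabits (s n)) _ (Hstep _ (Hs n))). }
  assert (HL : forall n, L (s n) = (1 / 2) ^ n).
  { induction n as [|n IH]; [reflexivity|].
    destruct (Hc n) as [E _]. rewrite E, IH. simpl. lra. }
  destruct (nested_intervals (fun n => X (s n)) (fun n => X (s n) + L (s n))) as [u Hu].
  { intros n. destruct (Hc n) as [E [E1 E2]]. lra. }
  { intros n. destruct (Hc n) as [E [E1 E2]]. lra. }
  { intros n. destruct (Hs n) as [E _]. lra. }
  destruct (nested_intervals (fun n => Y (s n)) (fun n => Y (s n) + L (s n))) as [v Hv].
  { intros n. destruct (Hc n) as [E [E1 E2]]. lra. }
  { intros n. destruct (Hc n) as [E [E1 E2]]. lra. }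
  { intros n. destruct (Hs n) as [E _]. lra. }
  assert (U0 := Hu 0%nat). assert (V0 := Hv 0%nat).
  unfold X, Y, L in U0, V0. simpl in U0, V0.
  destruct (Hloc u v) as [d [d0 Hd]]; try lra.
  destruct (pow_lt_1_zero (1 / 2)) with (y := d) as [N HN]; auto.
  { rewrite Rabs_pos_eq; lra. }
  specialize (HN N (le_n N)). rewrite <- HL in HN.
  destruct (Hs N) as [E1 E2]. apply E2.
  specialize (Hu N). specialize (Hv N). simpl in Hu, Hv.
  rewrite Rabs_pos_eq in HN by lra.
  apply Hd; lra.
Qed.

(** An antiderivative of the affine map A + B (z - z0). *)
Definition affine_primitive (A B z0 z : C) : C :=
  (A * z + B / 2 * ((z - z0) * (z - z0)))%C.

Lemma affine_primitive_deriv (A B z0 z : C) :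
  Cderiv (affine_primitive A B z0) z (A + B * (z - z0))%C.
Proof.
  unfold affine_primitive.
  assert (D : Cderiv (fun w => w - z0)%C z (RtoC 1)).
  { replace (RtoC 1) with (RtoC 1 + RtoC 0)%C by ring.
    apply (Cderiv_plus (fun w => w) (fun _ => - z0)%C); [apply Cderiv_id|apply Cderiv_const]. }
  replace (A + B * (z - z0))%C with
    ((0 * z + A * 1) + (0 * ((z - z0) * (z - z0)) + B / 2 * (1 * (z - z0) + (z - z0) * 1)))%C
    by field.
  apply (Cderiv_plus (fun w => A * w)%C (fun w => B / 2 * ((w - z0) * (w - z0)))%C).
  - apply (Cderiv_mult (fun _ => A) (fun w => w)); [apply Cderiv_const|apply Cderiv_id].
  - apply (Cderiv_mult (fun _ => B / 2)%C (fun w => (w - z0) * (w - z0))%C).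
    + apply Cderiv_const.
    + exact (Cderiv_mult _ _ _ _ _ D D).
Qed.

(** An affine map has an antiderivative, so its path integral depends only on the
    end points. This is why the first-order part of H drops out of the integral
    round a closed path. *)
Lemma path_integral_near_affine (H : C -> C) (A B z0 : C) (c dc : R -> C) (a b eta K : R) :
  a <= b -> 0 <= eta ->
  (forall t, a <= t <= b -> Rderiv c t (dc t)) ->
  (forall t, a <= t <= b -> Ccont dc t) ->
  (forall t, a <= t <= b -> Cmod (dc t) <= K) ->
  (forall t, a <= t <= b -> Cdiff H (c t)) ->
  (forall t, a <= t <= b -> Cmod (H (c t) - (A + B * (c t - z0))) <= eta) ->
  Cmod (CInt (fun t => H (c t) * dc t)%C a b
        - (affine_primitive A B z0 (c b) - affine_primitive A B z0 (c a)))
  <= (b - a) * (eta * K).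
Proof.
  intros Hab He Hc Hdc HK HH Hn.
  assert (I1 : is_CInt (fun t => H (c t) * dc t)%C a b (CInt (fun t => H (c t) * dc t)%C a b)).
  { apply CInt_correct; auto. intros t Ht. apply Ccont_mult; auto.
    apply (Ccont_comp H c); auto. apply (Rderiv_Ccont c t (dc t)); auto. }
  assert (I2 : is_CInt (fun t => (A + B * (c t - z0)) * dc t)%C a b
     (affine_primitive A B z0 (c b) - affine_primitive A B z0 (c a))%C).
  { apply (CInt_derive (fun t => affine_primitive A B z0 (c t))); auto; intros t Ht.
    - apply Rderiv_comp; auto. apply affine_primitive_deriv.
    - apply Ccont_mult; auto. apply Ccont_plus; [apply Ccont_const|].
      apply Ccont_mult; [apply Ccont_const|]. apply Ccont_plus; [|apply Ccont_const].
      apply (Rderiv_Ccont c t (dc t)); auto. }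
  eapply CInt_bound; [exact Hab| |exact (is_CInt_minus _ _ _ _ _ _ I1 I2)].
  intros t Ht. simpl.
  replace (H (c t) * dc t - (A + B * (c t - z0)) * dc t)%C
    with ((H (c t) - (A + B * (c t - z0))) * dc t)%C by ring.
  rewrite Cmod_mult. apply Rmult_le_compat; auto using Cmod_ge_0.
Qed.

(** The integral of H along the image under g of the positively oriented boundary
    of the square with corner (x, y) and side h; g1 and g2 stand for the partial
    derivatives of g. *)
Definition square_boundary (H : C -> C) (g g1 g2 : R -> R -> C) (x y h : R) : C :=
  (CInt (fun t => H (g t y) * g1 t y) x (x + h)
   + CInt (fun s => H (g (x + h)%R s) * g2 (x + h)%R s) y (y + h)
   - CInt (fun t => H (g t (y + h)%R) * g1 t (y + h)%R) x (x + h)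
   - CInt (fun s => H (g x s) * g2 x s) y (y + h))%C.

(** Differentiability at a point bounds the boundary integral of a small square
    of side h through that point by M h^2, for any prescribed M, because the affine
    part integrates to zero. Boundary integrals of four quarters add up to that of
    the whole, so the bound passes to the unit square. Bisecting the parameter
    square instead of a region of the plane makes the theorem a statement about
    homotopies. *)
Lemma goursat (H : C -> C) (g g1 g2 : R -> R -> C) (K : R) : 0 < K ->
  (forall t s, 0 <= t <= 1 -> 0 <= s <= 1 ->
     Rderiv (fun t => g t s) t (g1 t s) /\ Rderiv (g t) s (g2 t s)) ->
  (forall t s, 0 <= t <= 1 -> 0 <= s <= 1 ->
     Ccont (fun t => g1 t s) t /\ Ccont (g2 t) s) ->
  (forall t s, 0 <= t <= 1 -> 0 <= s <= 1 -> Cmod (g1 t s) <= K /\ Cmod (g2 t s) <= K) ->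
  (forall t s u v, 0 <= t <= 1 -> 0 <= s <= 1 -> 0 <= u <= 1 -> 0 <= v <= 1 ->
     Cmod (g t s - g u v) <= K * (Rabs (t - u) + Rabs (s - v))) ->
  (forall t s, 0 <= t <= 1 -> 0 <= s <= 1 -> Cdiff H (g t s)) ->
  square_boundary H g g1 g2 0 0 1 = 0%C.
Proof.
  intros K0 Hd Hc HK HL HH.
  assert (C1 : forall t s, 0 <= t <= 1 -> 0 <= s <= 1 -> Ccont (fun t => H (g t s) * g1 t s)%C t).
  { intros t s Ht Hs. destruct (Hd t s Ht Hs), (Hc t s Ht Hs). apply Ccont_mult; auto.
    apply (Ccont_comp H (fun t => g t s)); auto. eapply Rderiv_Ccont; eauto. }
  assert (C2 : forall t s, 0 <= t <= 1 -> 0 <= s <= 1 -> Ccont (fun s => H (g t s) * g2 t s)%C s).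
  { intros t s Ht Hs. destruct (Hd t s Ht Hs), (Hc t s Ht Hs). apply Ccont_mult; auto.
    apply (Ccont_comp H (g t)); auto. eapply Rderiv_Ccont; eauto. }
  assert (Small : forall M, 0 < M -> Cmod (square_boundary H g g1 g2 0 0 1) <= M).
  { intros M M0.
    replace M with (M * (1 * 1)) by ring.
    apply (dyadic_square_induction
             (fun x y h => Cmod (square_boundary H g g1 g2 x y h) <= M * (h * h))).
    - intros x y h h0 x0 x1 y0 y1 P1 P2 P3 P4.
      replace (square_boundary H g g1 g2 x y (h + h)) with
        (square_boundary H g g1 g2 x y h + square_boundary H g g1 g2 (x + h) y h
         + square_boundary H g g1 g2 x (y + h) h
         + square_boundary H g g1 g2 (x + h) (y + h) h)%C.
      + eapply Rle_trans; [apply Cmod_triangle|].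
        eapply Rle_trans; [apply Rplus_le_compat_r, Cmod_triangle|].
        eapply Rle_trans; [apply Rplus_le_compat_r, Rplus_le_compat_r, Cmod_triangle|].
        lra.
      + unfold square_boundary. rewrite <- !Rplus_assoc.
        assert (S1 : forall s, 0 <= s <= 1 ->
          CInt (fun t => H (g t s) * g1 t s)%C x (x + h + h)
          = (CInt (fun t => H (g t s) * g1 t s)%C x (x + h)
             + CInt (fun t => H (g t s) * g1 t s)%C (x + h)%R (x + h + h)%R)%C).
        { intros s Hs. apply CInt_split; try lra. intros t Ht. apply C1; lra. }
        assert (S2 : forall t, 0 <= t <= 1 ->
          CInt (fun s => H (g t s) * g2 t s)%C y (y + h + h)
          = (CInt (fun s => H (g t s) * g2 t s)%C y (y + h)
             + CInt (fun s => H (g t s) * g2 t s)%C (y + h)%R (y + h + h)%R)%C).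
        { intros t Ht. apply CInt_split; try lra. intros s Hs. apply C2; lra. }
        rewrite (S1 y), (S1 (y + h + h)), (S2 x), (S2 (x + h + h)) by lra.
        ring.
    - intros u v Hu Hv.
      destruct (HH u v Hu Hv) as [B HB].
      set (z0 := g u v) in *. set (A := H z0).
      (* On a square of side h through (u, v) the path stays within 2Kh of z0,
         so each edge contributes at most h K times the error eps (2Kh); with
         four edges, eps = M / (8 K^2) makes the total M h^2. *)
      assert (e0 : 0 < M / (8 * K * K)) by (apply Rdiv_lt_0_compat; nra).
      destruct (proj1 (Cderiv_eps H z0 B) HB _ e0) as [d [d0 D]].
      exists (d / (2 * K)). split; [apply Rdiv_lt_0_compat; lra|].
      intros x y h [h0 h1] Hx1 Hx2 Hy1 Hy2.
      assert (h2 : 2 * K * h < d).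
      { apply (Rmult_lt_compat_r (2 * K)) in h1; [|lra].
        replace (d / (2 * K) * (2 * K)) with d in h1 by (field; lra). lra. }
      assert (Near : forall t s, x <= t <= x + h -> y <= s <= y + h ->
        Cmod (H (g t s) - (A + B * (g t s - z0))) <= M / (8 * K * K) * (2 * K * h)).
      { intros t s Ht Hs.
        assert (E : Cmod (g t s - z0) <= 2 * K * h).
        { eapply Rle_trans; [apply HL; lra|].
          assert (Rabs (t - u) <= h) by (apply Rabs_le; lra).
          assert (Rabs (s - v) <= h) by (apply Rabs_le; lra).
          apply Rle_trans with (K * (h + h)); [apply Rmult_le_compat_l; lra|lra]. }
        replace (H (g t s) - (A + B * (g t s - z0)))%C with
          (H (g t s) - H z0 - (g t s - z0) * B)%C by (unfold A; ring).
        eapply Rle_trans; [apply D; lra|]. apply Rmult_le_compat_l; lra. }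
      set (eta := M / (8 * K * K) * (2 * K * h)) in *.
      assert (eta0 : 0 <= eta).
      { unfold eta. apply Rmult_le_pos; [lra|]. apply Rmult_le_pos; lra. }
      set (Pr := affine_primitive A B z0).
      assert (E1 : forall s, y <= s <= y + h ->
        Cmod (CInt (fun t => H (g t s) * g1 t s)%C x (x + h) - (Pr (g (x + h) s) - Pr (g x s)))
        <= h * (eta * K)).
      { intros s Hs. replace (h * (eta * K)) with ((x + h - x) * (eta * K)) by ring.
        apply (path_integral_near_affine H A B z0 (fun t => g t s) (fun t => g1 t s));
        try lra; intros t Ht.
        - apply Hd; lra.
        - apply Hc; lra.
        - apply HK; lra.
        - apply HH; lra.
        - apply Near; lra. }
      assert (E2 : forall t, x <= t <= x + h ->
        Cmod (CInt (fun s => H (g t s) * g2 t s)%C y (y + h) - (Pr (g t (y + h)%R) - Pr (g t y)))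
        <= h * (eta * K)).
      { intros t Ht. replace (h * (eta * K)) with ((y + h - y) * (eta * K)) by ring.
        apply (path_integral_near_affine H A B z0 (g t) (g2 t));
        try lra; intros s Hs.
        - apply Hd; lra.
        - apply Hc; lra.
        - apply HK; lra.
        - apply HH; lra.
        - apply Near; lra. }
      assert (F1 := E1 y ltac:(lra)). assert (F2 := E1 (y + h) ltac:(lra)).
      assert (F3 := E2 x ltac:(lra)). assert (F4 := E2 (x + h) ltac:(lra)).
      replace (M * (h * h)) with (h * (eta * K) + h * (eta * K) + h * (eta * K) + h * (eta * K))
        by (unfold eta; field; lra).
      unfold square_boundary.
      set (I1 := CInt _ _ _ : C) in F1. set (I2 := CInt _ _ _ : C) in F2.
      set (I3 := CInt _ _ _ : C) in F3. set (I4 := CInt _ _ _ : C) in F4.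
      fold I1 I2 I3 I4. clearbody I1 I2 I3 I4.
      replace (I1 + I4 - I2 - I3)%C with
        (((I1 : C) - (Pr (g (x + h)%R y) - Pr (g x y)))
         + (I4 - (Pr (g (x + h)%R (y + h)%R) - Pr (g (x + h)%R y)))
         + - (I2 - (Pr (g (x + h)%R (y + h)%R) - Pr (g x (y + h)%R)))
         + - (I3 - (Pr (g x (y + h)%R) - Pr (g x y))))%C by ring.
      eapply Rle_trans; [apply Cmod_triangle|].
      eapply Rle_trans; [apply Rplus_le_compat_r, Cmod_triangle|].
      eapply Rle_trans; [apply Rplus_le_compat_r, Rplus_le_compat_r, Cmod_triangle|].
      rewrite !Cmod_opp. lra. }
  apply Cmod_eq_0. apply Rle_antisym; [|apply Cmod_ge_0].
  apply Rnot_lt_le. intros Hpos.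
  specialize (Small (Cmod (square_boundary H g g1 g2 0 0 1) / 2)). lra.
Qed.

(** * Cauchy's formula on a circle *)

(** Full turns as unit of angle: integrals over [0, 1] are then means over the
    circle, and no factor 2 pi is left in Cauchy's formula. *)
Definition turn (s : R) : C := (cos (2 * PI * s), sin (2 * PI * s)).

Lemma Cmod_turn (s : R) : Cmod (turn s) = 1.
Proof.
  unfold Cmod, turn; simpl fst; simpl snd. rewrite <- sqrt_1. f_equal.
  rewrite <- (sin2_cos2 (2 * PI * s)). unfold Rsqr. ring.
Qed.

Lemma turn_neq_0 (s : R) : turn s <> 0%C.
Proof. apply Cmod_gt_0. rewrite Cmod_turn. lra. Qed.

Lemma turn_0 : turn 0 = 1%C.
Proof. unfold turn. rewrite Rmult_0_r, cos_0, sin_0. reflexivity. Qed.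

Lemma turn_1 : turn 1 = 1%C.
Proof. unfold turn. rewrite Rmult_1_r, cos_2PI, sin_2PI. reflexivity. Qed.

Definition two_pi_i : C := (RtoC (2 * PI) * Ci)%C.

Lemma Cmod_two_pi_i : Cmod two_pi_i = 2 * PI.
Proof.
  unfold two_pi_i. rewrite Cmod_mult, Cmod_Ci, Cmod_R, Rabs_pos_eq; [ring|].
  assert (H := PI_RGT_0). lra.
Qed.

Lemma turn_deriv (s : R) : Rderiv turn s (two_pi_i * turn s)%C.
Proof.
  apply Rderiv_pair; unfold turn, two_pi_i, Ci, RtoC, Cmult, Re, Im; simpl;
  auto_derive; auto; ring.
Qed.

Lemma turn_Ccont (s : R) : Ccont turn s.
Proof. eapply Rderiv_Ccont, turn_deriv. Qed.

Lemma turn_lipschitz (s v : R) : Cmod (turn s - turn v) <= 2 * PI * Rabs (s - v).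
Proof.
  assert (G : forall a b, a <= b -> Cmod (turn b - turn a) <= 2 * PI * (b - a)).
  { intros a b Hab.
    apply (mean_value_bound turn (fun s => two_pi_i * turn s)%C); auto.
    - apply turn_deriv.
    - intros t. apply Ccont_mult; [apply Ccont_const|apply turn_Ccont].
    - intros t. rewrite Cmod_mult, Cmod_turn, Cmod_two_pi_i. lra. }
  destruct (Rle_dec v s) as [L|L].
  - rewrite Rabs_pos_eq by lra. auto.
  - rewrite Rabs_left by lra.
    replace (turn s - turn v)%C with (- (turn v - turn s))%C by ring.
    rewrite Cmod_opp. eapply Rle_trans; [apply G; lra|]. lra.
Qed.

Lemma Cmod_circle (rho s : R) : 0 <= rho -> Cmod (rho * turn s) = rho.
Proof. intros H. rewrite Cmod_mult, Cmod_turn, Cmod_R, Rabs_pos_eq; lra. Qed.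

Lemma circle_neq (rho s : R) (z : C) : Cmod z < rho -> (RtoC rho * turn s)%C <> z.
Proof.
  intros H E. assert (H0 := Cmod_ge_0 z).
  apply (f_equal Cmod) in E. rewrite Cmod_circle in E; lra.
Qed.

Lemma circle_dist (rho s : R) (z : C) : 0 <= rho -> rho - Cmod z <= Cmod (rho * turn s - z).
Proof. intros H. rewrite <- (Cmod_circle rho s H) at 1. apply Cmod_minus_ge. Qed.

Lemma circle_Ccont (rho s : R) : Ccont (fun s => rho * turn s)%C s.
Proof. apply (Ccont_mult (fun _ => RtoC rho)); [apply Ccont_const|apply turn_Ccont]. Qed.

(** The circle of radius rho about the origin is deformed into a small circle
    about z inside the region where F w / (w - z) is differentiable; on the small
    circle the kernel is constant in the turn parameter. *)
Lemma cauchy_homotopy (F : C -> C) (rho eps : R) (z : C) :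
  Cmod z < rho -> 0 < eps <= rho - Cmod z ->
  (forall w, Cmod w <= rho -> Cdiff F w) ->
  CInt (fun s => F (rho * turn s) * ((rho * turn s) / (rho * turn s - z)))%C 0 1
  = CInt (fun s => F (z + eps * turn s))%C 0 1.
Proof.
  intros Hz He HF. assert (Hz0 := Cmod_ge_0 z). assert (HPI := PI_RGT_0).
  (* g t runs round the circle with centre (1 - t) z and radius
     (1 - t) eps + t rho, which lies in the closed disk and encloses z. *)
  set (g := fun t s => ((z + eps * turn s) + RtoC t * (- z + (rho - eps)%R * turn s))%C).
  set (g1 := fun (_ s : R) => (- z + (rho - eps)%R * turn s)%C).
  set (g2 := fun t s => (two_pi_i * ((eps + t * (rho - eps))%R * turn s))%C).
  set (H := fun w => (F w * / (w - z))%C).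
  set (K := 2 * rho + 2 * PI * rho).
  assert (Hsig : forall t, 0 <= t <= 1 -> eps <= eps + t * (rho - eps) <= rho).
  { intros t Ht. split; [|nra].
    assert (0 <= t * (rho - eps)) by (apply Rmult_le_pos; lra). lra. }
  assert (Hg : forall t s, g t s = (z * (1 - t)%R + (eps + t * (rho - eps))%R * turn s)%C).
  { intros t s. unfold g. rewrite !RtoC_minus, RtoC_plus, RtoC_mult, RtoC_minus. ring. }
  assert (Hg1 : forall t s, Cmod (g1 t s) <= 2 * rho).
  { intros t s. unfold g1. eapply Rle_trans; [apply Cmod_triangle|].
    rewrite Cmod_opp, Cmod_mult, Cmod_turn, Cmod_R, Rabs_pos_eq; lra. }
  assert (Hg2 : forall t s, 0 <= t <= 1 -> Cmod (g2 t s) <= 2 * PI * rho).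
  { intros t s Ht. specialize (Hsig t Ht). unfold g2.
    rewrite !Cmod_mult, Cmod_two_pi_i, Cmod_turn, Cmod_R, Rabs_pos_eq by lra.
    rewrite Rmult_1_r. apply Rmult_le_compat_l; lra. }
  assert (Hgs : forall t s, Rderiv (g t) s (g2 t s)).
  { intros t s.
    apply (Rderiv_ext (fun s => z * (1 - t)%R + (eps + t * (rho - eps))%R * turn s)%C).
    { intros u. symmetry; apply Hg. }
    replace (g2 t s) with ((eps + t * (rho - eps))%R * (two_pi_i * turn s))%C
      by (unfold g2; ring).
    apply (Rderiv_comp (fun w => z * (1 - t)%R + (eps + t * (rho - eps))%R * w)%C turn).
    - apply Cderiv_affine.
    - apply turn_deriv. }
  assert (Hg2c : forall t s, Ccont (g2 t) s).
  { intros t s. apply (Ccont_mult (fun _ => two_pi_i)); [apply Ccont_const|].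
    apply (Ccont_mult (fun _ => RtoC (eps + t * (rho - eps)))); [apply Ccont_const|apply turn_Ccont]. }
  assert (Hball : forall t s, 0 <= t <= 1 -> Cmod (g t s) <= rho /\ g t s <> z).
  { intros t s Ht. specialize (Hsig t Ht). rewrite Hg. split.
    - eapply Rle_trans; [apply Cmod_triangle|].
      rewrite !Cmod_mult, Cmod_turn, !Cmod_R, !Rabs_pos_eq by lra.
      assert (eps * (1 - t) <= (rho - Cmod z) * (1 - t)) by (apply Rmult_le_compat_r; lra). lra.
    - intros E. apply Ceq_minus in E.
      replace (z * (1 - t)%R + (eps + t * (rho - eps))%R * turn s - z)%C
        with ((eps + t * (rho - eps))%R * turn s - t * z)%C in E by (rewrite RtoC_minus; ring).
      assert (T := Cmod_minus_ge ((eps + t * (rho - eps))%R * turn s) (t * z)).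
      rewrite E, Cmod_0, !Cmod_mult, Cmod_turn, !Cmod_R, !Rabs_pos_eq in T by lra.
      assert (0 <= t * (rho - Cmod z)) by (apply Rmult_le_pos; lra).
      assert (t = 1 \/ 0 < eps * (1 - t)).
      { destruct (Req_dec t 1); [left; auto|right]. apply Rmult_lt_0_compat; lra. }
      destruct H1 as [-> |]; lra. }
  assert (G : square_boundary H g g1 g2 0 0 1 = 0%C).
  { apply goursat with (K := K).
    - unfold K. nra.
    - intros t s Ht Hs. split.
      + apply Rderiv_affine.
      + apply Hgs.
    - intros t s Ht Hs. split; [apply Ccont_const|apply Hg2c].
    - intros t s Ht Hs. specialize (Hg1 t s). specialize (Hg2 t s Ht).
      unfold K. assert (0 <= 2 * PI * rho) by nra. split; lra.
    - intros t s u v Ht Hs Hu Hv.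
      replace (g t s - g u v)%C with
        ((t - u)%R * g1 t v + (eps + t * (rho - eps))%R * (turn s - turn v))%C.
      2:{ unfold g, g1. rewrite !RtoC_minus, RtoC_plus, RtoC_mult, RtoC_minus. ring. }
      eapply Rle_trans; [apply Cmod_triangle|]. rewrite !Cmod_mult, !Cmod_R.
      specialize (Hg1 t v). specialize (Hsig t Ht). rewrite (Rabs_pos_eq (_ + _)) by lra.
      assert (T := turn_lipschitz s v).
      assert (A1 := Rabs_pos (t - u)). assert (A2 := Rabs_pos (s - v)).
      apply Rle_trans with (Rabs (t - u) * (2 * rho) + rho * (2 * PI * Rabs (s - v))).
      + apply Rplus_le_compat; apply Rmult_le_compat; try lra; apply Cmod_ge_0.
      + unfold K. assert (0 <= rho * PI) by nra. nra.
    - intros t s Ht Hs. destruct (Hball t s Ht) as [B1 B2]. unfold H.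
      apply Cdiff_mult; [apply HF; auto|apply Cdiff_shift_inv; auto]. }
  unfold square_boundary in G. rewrite Rplus_0_l in G.
  set (b1 := CInt _ _ _ : C) in G at 1. set (V1 := CInt _ _ _ : C) in G at 1.
  set (b2 := CInt _ _ _ : C) in G at 1. set (V0 := CInt _ _ _ : C) in G.
  (* The two edges s = 0 and s = 1 are the same path. *)
  assert (Eb : b1 = b2).
  { unfold b1, b2, g, g1. rewrite turn_0, turn_1. reflexivity. }
  assert (E : V1 = V0).
  { replace V1 with (V1 + (b1 + V1 - b2 - V0) * 0)%C by ring.
    rewrite <- Eb in G. replace V0 with (V0 + (b1 + V1 - b1 - V0))%C by (rewrite G; ring). ring. }
  assert (Ha : two_pi_i <> 0%C) by (apply Cmod_gt_0; rewrite Cmod_two_pi_i; lra).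
  assert (J1 : CInt (fun s => F (rho * turn s) * ((rho * turn s) / (rho * turn s - z)))%C 0 1
               = (/ two_pi_i * V1)%C).
  { apply is_CInt_unique.
    apply (is_CInt_ext (fun s => / two_pi_i * (H (g 1 s) * g2 1%R s))%C); [lra| |].
    - intros s Hs. rewrite Hg. unfold H, g2.
      replace (eps + 1 * (rho - eps)) with rho by ring.
      replace (z * (1 - 1)%R + rho * turn s)%C with (rho * turn s)%C.
      2:{ rewrite RtoC_minus. ring. }
      field. split; auto.
      intros E'. assert (T := Cmod_minus_ge (rho * turn s) z).
      rewrite E', Cmod_0, Cmod_mult, Cmod_turn, Cmod_R, Rabs_pos_eq in T; lra.
    - apply is_CInt_scal. apply CInt_correct; [lra|]. intros s Hs.
      apply Ccont_mult.
      + apply (Ccont_comp H (g 1)).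
        * destruct (Hball 1 s ltac:(lra)) as [B1 B2]. unfold H.
          apply Cdiff_mult; [apply HF; auto|apply Cdiff_shift_inv; auto].
        * apply (Rderiv_Ccont _ _ _ (Hgs _ _)).
      + apply Hg2c. }
  rewrite J1, E. symmetry. apply is_CInt_unique.
  apply (is_CInt_ext (fun s => / two_pi_i * (H (g 0 s) * g2 0%R s))%C); [lra| |].
  - intros s Hs. rewrite Hg. unfold H, g2.
    replace (eps + 0 * (rho - eps)) with eps by ring.
    replace (z * (1 - 0)%R + eps * turn s)%C with (z + eps * turn s)%C.
    2:{ rewrite RtoC_minus. ring. }
    replace (z + eps * turn s - z)%C with (eps * turn s)%C by ring.
    field. repeat split; auto using turn_neq_0. apply RtoC_neq_0. lra.
  - apply is_CInt_scal. apply CInt_correct; [lra|]. intros s Hs.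
    apply Ccont_mult.
    + apply (Ccont_comp H (g 0)).
      * destruct (Hball 0 s ltac:(lra)) as [B1 B2]. unfold H.
        apply Cdiff_mult; [apply HF; auto|apply Cdiff_shift_inv; auto].
      * apply (Rderiv_Ccont _ _ _ (Hgs _ _)).
    + apply Hg2c.
Qed.

(** The mean over a small circle about z tends to F z, and it does not depend on
    the small radius. *)
Lemma cauchy_formula (F : C -> C) (rho : R) (z : C) : Cmod z < rho ->
  (forall w, Cmod w <= rho -> Cdiff F w) ->
  is_CInt (fun s => F (rho * turn s) * ((rho * turn s) / (rho * turn s - z)))%C 0 1 (F z).
Proof.
  intros Hz HF. assert (Hz0 := Cmod_ge_0 z).
  assert (I : is_CInt (fun s => F (rho * turn s) * ((rho * turn s) / (rho * turn s - z)))%C 0 1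
    (CInt (fun s => F (rho * turn s) * ((rho * turn s) / (rho * turn s - z)))%C 0 1)).
  { apply CInt_correct; [lra|]. intros s _.
    assert (Cc : Ccont (fun s => rho * turn s)%C s)
      by (apply Ccont_mult; [apply Ccont_const|apply turn_Ccont]).
    apply Ccont_mult; [|apply Ccont_mult; [exact Cc|]].
    - apply (Ccont_comp F (fun s => rho * turn s)%C); auto. apply HF.
      rewrite Cmod_mult, Cmod_turn, Cmod_R, Rabs_pos_eq; lra.
    - apply (Ccont_comp (fun w => / (w - z))%C (fun s => rho * turn s)%C); auto.
      apply Cdiff_shift_inv. apply circle_neq; auto. }
  set (J := CInt _ _ _ : C) in I.
  replace (F z) with J; [exact I|].
  apply Ceq_minus. apply Cmod_eq_0. apply Rle_antisym; [|apply Cmod_ge_0].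
  apply Rnot_lt_le. intros Hpos.
  destruct (Cdiff_cont_eps F z (HF z ltac:(lra)) (Cmod (J - F z) / 2) ltac:(lra)) as [d [d0 D]].
  set (eps := Rmin (d / 2) (rho - Cmod z)).
  assert (He : 0 < eps <= rho - Cmod z).
  { split; [apply Rmin_pos; lra|apply Rmin_r]. }
  assert (Hed : eps < d) by (assert (eps <= d / 2) by apply Rmin_l; lra).
  assert (EJ : J = CInt (fun s => F (z + eps * turn s))%C 0 1) by (apply cauchy_homotopy; auto).
  assert (I2 : is_CInt (fun s => F (z + eps * turn s))%C 0 1 J).
  { rewrite EJ. apply CInt_correct; [lra|]. intros s _.
    apply (Ccont_comp F (fun s => z + eps * turn s)%C).
    - apply HF. eapply Rle_trans; [apply Cmod_triangle|].
      rewrite Cmod_mult, Cmod_turn, Cmod_R, Rabs_pos_eq; lra.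
    - apply Ccont_plus; [apply Ccont_const|apply Ccont_mult; [apply Ccont_const|apply turn_Ccont]]. }
  assert (B := CInt_bound _ 0 1 _ (Cmod (J - F z) / 2) Rle_0_1 (fun s _ => Rlt_le _ _ (D (z + eps * turn s)%C
    ltac:(replace (z + eps * turn s - z)%C with (eps * turn s)%C by ring;
          rewrite Cmod_mult, Cmod_turn, Cmod_R, Rabs_pos_eq; lra)))
    (is_CInt_minus _ _ _ _ _ _ I2 (is_CInt_const (F z)))).
  lra.
Qed.

(** * Iterated derivatives as Cauchy integrals *)

Lemma pow_difference_bound (M : R) (k : nat) : 0 <= M -> exists L, 0 <= L /\
  forall h u v : C, Cmod u <= M -> Cmod v <= M -> (v - u = h * (u * v))%C ->
  Cmod (v ^ k - u ^ k) <= L * Cmod h.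
Proof.
  intros HM. induction k as [|k [L [L0 IH]]].
  - exists 0. split; [lra|]. intros h u v _ _ _. simpl.
    replace (1 - 1)%C with (RtoC 0) by ring. rewrite Cmod_0. lra.
  - exists (M * L + M * M * M ^ k). assert (P := pow_le M k HM).
    split; [assert (0 <= M * L) by nra; assert (0 <= M * M) by nra; nra|].
    intros h u v Hu Hv E. rewrite !Cpow_S.
    replace (v * v ^ k - u * u ^ k)%C with (v * (v ^ k - u ^ k) + (v - u) * u ^ k)%C by ring.
    rewrite E. eapply Rle_trans; [apply Cmod_triangle|]. rewrite !Cmod_mult, Cmod_pow.
    rewrite Rmult_plus_distr_r. apply Rplus_le_compat.
    + rewrite Rmult_assoc. apply Rmult_le_compat; auto using Cmod_ge_0.
    + replace (M * M * M ^ k * Cmod h) with (Cmod h * (M * M) * M ^ k) by ring.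
      apply Rmult_le_compat; auto using pow_le, Cmod_ge_0.
      * repeat apply Rmult_le_pos; apply Cmod_ge_0.
      * apply Rmult_le_compat_l; [apply Cmod_ge_0|]. apply Rmult_le_compat; auto using Cmod_ge_0.
      * apply pow_incr. split; auto using Cmod_ge_0.
Qed.

(** Applied to u = 1 / (x - z) and v = 1 / (x - w) with h = w - z, this is the
    first-order expansion in w of the k-th power of the Cauchy kernel, uniformly
    in x on the circle. *)
Lemma pow_expansion_bound (M : R) (k : nat) : 0 <= M -> exists L, 0 <= L /\
  forall h u v : C, Cmod u <= M -> Cmod v <= M -> (v - u = h * (u * v))%C ->
  Cmod (v ^ k - u ^ k - h * (INR k * u ^ S k)) <= L * (Cmod h * Cmod h).
Proof.
  intros HM. induction k as [|k [L [L0 IH]]].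
  - exists 0. split; [lra|]. intros h u v _ _ _. simpl.
    replace (1 - 1 - h * (0 * (u * 1)))%C with (RtoC 0) by ring. rewrite Cmod_0. lra.
  - destruct (pow_difference_bound M (S k) HM) as [L1 [L10 H1]].
    exists (M * L1 + M * L). split; [nra|]. intros h u v Hu Hv E.
    (* Only v - u = h u v is used, which is where the error of the next power
       splits into a first-order difference times h and the previous error. *)
    replace (v ^ S k - u ^ S k - h * (INR (S k) * u ^ S (S k)))%C with
      (h * u * (v ^ S k - u ^ S k) + u * (v ^ k - u ^ k - h * (INR k * u ^ S k)))%C.
    + eapply Rle_trans; [apply Cmod_triangle|]. rewrite !Cmod_mult.
      rewrite Rmult_plus_distr_r. apply Rplus_le_compat.
      * replace (M * L1 * (Cmod h * Cmod h)) with (Cmod h * M * (L1 * Cmod h)) by ring.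
        apply Rmult_le_compat; auto using Cmod_ge_0.
        -- apply Rmult_le_pos; apply Cmod_ge_0.
        -- apply Rmult_le_compat_l; auto using Cmod_ge_0.
      * rewrite Rmult_assoc. apply Rmult_le_compat; auto using Cmod_ge_0.
    + rewrite S_INR, RtoC_plus, !Cpow_S.
      replace (v * v ^ k - u * u ^ k - h * ((INR k + 1) * (u * (u * u ^ k))))%C with
        ((v - u) * v ^ k + u * v ^ k - u * u ^ k - h * ((INR k + 1) * (u * (u * u ^ k))))%C by ring.
      rewrite E. ring.
Qed.

Definition cauchy_integral (phi : R -> C) (rho : R) (k : nat) (z : C) : C :=
  CInt (fun s => phi s * (/ (rho * turn s - z)) ^ k)%C 0 1.

Lemma kernel_Ccont (rho : R) (z : C) (k : nat) (s : R) : Cmod z < rho ->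
  Ccont (fun s => (/ (rho * turn s - z)) ^ k)%C s.
Proof.
  intros H. apply Ccont_pow.
  apply (Ccont_comp (fun w => / (w - z))%C (fun s => rho * turn s)%C).
  - apply Cdiff_shift_inv, circle_neq, H.
  - apply circle_Ccont.
Qed.

Lemma cauchy_integral_correct (phi : R -> C) (rho : R) (k : nat) (z : C) : Cmod z < rho ->
  (forall s, 0 <= s <= 1 -> Ccont phi s) ->
  is_CInt (fun s => phi s * (/ (rho * turn s - z)) ^ k)%C 0 1 (cauchy_integral phi rho k z).
Proof.
  intros Hz Hphi. apply CInt_correct; [lra|]. intros s Hs.
  apply Ccont_mult; auto using kernel_Ccont.
Qed.

(** Differentiation under the integral sign, by integrating the uniform expansion
    of the kernel. *)
Lemma cauchy_integral_deriv (phi : R -> C) (B rho : R) (k : nat) (z : C) : Cmod z < rho ->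
  (forall s, 0 <= s <= 1 -> Ccont phi s) ->
  (forall s, 0 <= s <= 1 -> Cmod (phi s) <= B) ->
  Cderiv (cauchy_integral phi rho k) z (INR k * cauchy_integral phi rho (S k) z)%C.
Proof.
  intros Hz Hphi HB. assert (Hz0 := Cmod_ge_0 z).
  assert (B0 : 0 <= B) by (eapply Rle_trans; [apply Cmod_ge_0|apply (HB 0); lra]).
  set (r := (rho - Cmod z) / 2). assert (r0 : 0 < r) by (unfold r; lra).
  assert (M0 : 0 <= / r) by (left; apply Rinv_0_lt_compat; auto).
  destruct (pow_expansion_bound (/ r) k M0) as [L [L0 HL]].
  assert (BL : 0 <= B * L) by (apply Rmult_le_pos; auto).
  apply Cderiv_eps. intros eps He.
  exists (Rmin r (eps / (B * L + 1))). split.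
  { apply Rmin_pos; auto. apply Rdiv_lt_0_compat; lra. }
  intros w Hw.
  assert (W1 := Rlt_le_trans _ _ _ Hw (Rmin_l _ _)).
  assert (W2 := Rlt_le_trans _ _ _ Hw (Rmin_r _ _)).
  assert (Hwm : Cmod w <= Cmod z + Cmod (w - z)).
  { replace w with (z + (w - z))%C at 1 by ring. apply Cmod_triangle. }
  assert (Hw2 : Cmod w < rho) by (unfold r in *; lra).
  assert (I := is_CInt_minus _ _ _ _ _ _
    (is_CInt_minus _ _ _ _ _ _ (cauchy_integral_correct phi rho k w Hw2 Hphi)
       (cauchy_integral_correct phi rho k z Hz Hphi))
    (is_CInt_scal ((w - z) * INR k)%C _ _ _ _ (cauchy_integral_correct phi rho (S k) z Hz Hphi))).
  replace (cauchy_integral phi rho k w - cauchy_integral phi rho k z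
           - (w - z) * (INR k * cauchy_integral phi rho (S k) z))%C with
    (cauchy_integral phi rho k w - cauchy_integral phi rho k z
           - (w - z) * INR k * cauchy_integral phi rho (S k) z)%C by ring.
  apply Rle_trans with ((1 - 0) * (B * (L * (Cmod (w - z) * Cmod (w - z))))).
  - eapply CInt_bound; [lra| |exact I]. intros s Hs. cbv beta.
    set (u := (/ (rho * turn s - z))%C). set (v := (/ (rho * turn s - w))%C).
    replace (phi s * v ^ k - phi s * u ^ k - (w - z) * INR k * (phi s * u ^ S k))%C with
      (phi s * (v ^ k - u ^ k - (w - z) * (INR k * u ^ S k)))%C by ring.
    rewrite Cmod_mult.
    assert (N1 : (rho * turn s - z <> 0)%C) by (apply Cminus_eq_contra, circle_neq; auto).
    assert (N2 : (rho * turn s - w <> 0)%C) by (apply Cminus_eq_contra, circle_neq; auto).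
    apply Rmult_le_compat; auto using Cmod_ge_0.
    apply HL.
    + unfold u. rewrite Cmod_inv by auto. apply Rinv_le_contravar; auto.
      eapply Rle_trans; [|apply circle_dist; lra]. unfold r; lra.
    + unfold v. rewrite Cmod_inv by auto. apply Rinv_le_contravar; auto.
      eapply Rle_trans; [|apply circle_dist; lra]. unfold r in *; lra.
    + unfold u, v. field. auto.
  - assert (H := Cmod_ge_0 (w - z)).
    replace ((1 - 0) * (B * (L * (Cmod (w - z) * Cmod (w - z)))))
      with (B * L * Cmod (w - z) * Cmod (w - z)) by ring.
    apply Rmult_le_compat_r; auto.
    apply (Rmult_lt_compat_r (B * L + 1)) in W2; [|lra].
    unfold Rdiv in W2. rewrite Rmult_assoc, Rinv_l in W2 by lra. nra.
Qed.

(** Cauchy's formula holds at every point of the open disk, so it can be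
    differentiated repeatedly; existence of the next derivative and its value come
    together in the induction. *)
Lemma cauchy_derivatives (f : C -> C) (B rho : R) (k : nat) : forall z : C, Cmod z < rho ->
  (forall w, Cmod w <= rho -> Cdiff f w) ->
  (forall w, Cmod w <= rho -> Cmod (f w) <= B) ->
  C_derive_n f k z
  = (INR (fact k) * cauchy_integral (fun s => f (rho * turn s) * (rho * turn s)) rho (S k) z)%C.
Proof.
  intros z Hz Hf HB. revert z Hz.
  assert (Hon : forall s, 0 <= rho -> Cmod (rho * turn s) <= rho).
  { intros s H. rewrite Cmod_circle; lra. }
  induction k as [|k IH]; intros z Hz; assert (Hz0 := Cmod_ge_0 z).
  - simpl fact. simpl INR. rewrite Cmult_1_l. simpl C_derive_n.
    symmetry. apply is_CInt_unique. eapply is_CInt_ext; [lra| |exact (cauchy_formula f rho z Hz Hf)].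
    intros s _. cbv beta. rewrite Cpow_1_r. unfold Cdiv. ring.
  - simpl C_derive_n. apply is_C_derive_unique.
    apply (Cderiv_ext_loc
      (fun w => INR (fact k) * cauchy_integral (fun s => f (rho * turn s) * (rho * turn s)) rho (S k) w)%C
      _ z _ (rho - Cmod z)); [lra| |].
    + intros w Hw. symmetry. apply IH.
      assert (Hwm : Cmod w <= Cmod z + Cmod (w - z)).
      { replace w with (z + (w - z))%C at 1 by ring. apply Cmod_triangle. }
      lra.
    + set (phi := fun s => (f (rho * turn s) * (rho * turn s))%C).
      replace (INR (fact (S k)) * cauchy_integral phi rho (S (S k)) z)%C with
        (0 * cauchy_integral phi rho (S k) z
         + INR (fact k) * (INR (S k) * cauchy_integral phi rho (S (S k)) z))%C.
      * apply (Cderiv_mult (fun _ => RtoC (INR (fact k)))); [apply Cderiv_const|].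
        apply (cauchy_integral_deriv phi (B * rho)); auto.
        -- intros s _. apply Ccont_mult; [|apply circle_Ccont].
           apply (Ccont_comp f (fun s => rho * turn s)%C); [|apply circle_Ccont].
           apply Hf, Hon. lra.
        -- intros s _. unfold phi. rewrite Cmod_mult, Cmod_circle by lra.
           apply Rmult_le_compat_r; [lra|]. apply HB, Hon. lra.
      * rewrite fact_simpl, mult_INR, RtoC_mult. ring.
Qed.

(** * Bounds on the Taylor coefficients *)

(** The function w -> rho^2 - conj z w vanishes only at the mirror image of z in
    the circle of radius rho, which is outside the closed disk. *)
Lemma reflected_neq_0 (rho : R) (z w : C) : Cmod z < rho -> Cmod w <= rho ->
  (RtoC (rho * rho) - Cconj z * w)%C <> 0%C.
Proof.
  intros Hz Hw E. assert (H0 := Cmod_ge_0 z).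
  assert (T := Cmod_minus_ge (RtoC (rho * rho)) (Cconj z * w)).
  rewrite E, Cmod_0, Cmod_mult, Cmod_conj, Cmod_R, Rabs_pos_eq in T by nra.
  assert (Cmod z * Cmod w <= Cmod z * rho) by (apply Rmult_le_compat_l; auto). nra.
Qed.

Lemma Cdiff_reflected_inv (rho : R) (z w : C) : Cmod z < rho -> Cmod w <= rho ->
  Cdiff (fun w => / (RtoC (rho * rho) - Cconj z * w))%C w.
Proof.
  intros Hz Hw. apply (Cdiff_ext (fun w => / (RtoC (rho * rho) + (- Cconj z) * w))%C).
  - intros u. f_equal. ring.
  - apply (Cdiff_inv (fun w => RtoC (rho * rho) + (- Cconj z) * w)%C); [apply Cdiff_affine|].
    replace (RtoC (rho * rho) + (- Cconj z) * w)%C with (RtoC (rho * rho) - Cconj z * w)%C by ring.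
    apply reflected_neq_0; auto.
Qed.

Lemma circle_conj (rho s : R) : 0 < rho ->
  Cconj (rho * turn s) = (RtoC (rho * rho) / (rho * turn s))%C.
Proof.
  intros H. assert (E := Cmod2_conj (rho * turn s)). rewrite Cmod_circle in E by lra.
  replace (RtoC (rho * rho)) with (rho * turn s * Cconj (rho * turn s))%C.
  - field. split; [apply turn_neq_0|apply RtoC_neq_0; lra].
  - rewrite <- E. f_equal. ring.
Qed.

Lemma circle_reflected (rho s : R) (z : C) : 0 < rho ->
  (RtoC (rho * rho) - Cconj z * (rho * turn s) = rho * turn s * Cconj (rho * turn s - z))%C.
Proof.
  intros H. rewrite Cminus_conj, circle_conj by auto. field.
  split; [apply turn_neq_0|apply RtoC_neq_0; lra].
Qed.

(** Conjugation exchanges, on the circle, the kernel with a function holomorphic in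
    the closed disk that vanishes at the origin, so the mean is the conjugate of the
    value 0 at the centre. *)
Lemma conj_integral_vanishes (f : C -> C) (rho : R) (z : C) (k : nat) : Cmod z < rho ->
  (forall w, Cmod w <= rho -> Cdiff f w) ->
  is_CInt (fun s => Cconj (f (rho * turn s))
                    * ((rho * turn s) * (/ (rho * turn s - z)) ^ (S (S k))))%C 0 1 (RtoC 0).
Proof.
  intros Hz Hf. assert (Hz0 := Cmod_ge_0 z).
  (* On the circle, G is f times the conjugate of the kernel. *)
  set (G := fun w => (f w * (RtoC (rho * rho) * (w ^ (S k)
                * (/ (RtoC (rho * rho) - Cconj z * w)) ^ (S (S k)))))%C).
  assert (HG : forall w, Cmod w <= rho -> Cdiff G w).
  { intros w Hw. apply Cdiff_mult; [auto|].
    apply (Cdiff_mult (fun _ => RtoC (rho * rho))); [apply Cdiff_const|].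
    apply Cdiff_mult.
    - apply (Cdiff_pow (fun w => w)), Cdiff_id.
    - apply Cdiff_pow. apply Cdiff_reflected_inv; auto. }
  assert (Z : Cmod 0 < rho) by (rewrite Cmod_0; lra).
  assert (I := is_CInt_conj _ _ _ _ (cauchy_formula G rho (RtoC 0) Z HG)).
  replace (Cconj (G 0%C)) with (RtoC 0) in I.
  2:{ unfold G. rewrite (Cpow_S 0 k). 
      replace (f 0 * _)%C with (RtoC 0) by ring. unfold Cconj; simpl. rewrite Ropp_0. reflexivity. }
  eapply is_CInt_ext; [lra| |exact I]. intros s _. cbv beta.
  assert (N0 : (rho * turn s)%C <> 0%C).
  { apply Cmult_neq_0; [apply RtoC_neq_0; lra|apply turn_neq_0]. }
  assert (N1 : (rho * turn s - z <> 0)%C) by (apply Cminus_eq_contra, circle_neq; auto).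
  assert (N2 := Cconj_neq_0 _ N1).
  unfold G. rewrite circle_reflected by lra.
  set (ze := (rho * turn s)%C) in *.
  replace (f ze * (RtoC (rho * rho) * (ze ^ S k * (/ (ze * Cconj (ze - z))) ^ S (S k)))
           * (ze / (ze - 0)))%C
    with (f ze * ((RtoC (rho * rho) / ze) * (/ Cconj (ze - z)) ^ S (S k)))%C.
  - assert (Ec : Cconj ze = (RtoC (rho * rho) / ze)%C) by (apply circle_conj; lra).
    rewrite <- Ec,  !Cmult_conj, Cpow_conj, Cinv_conj, !Cconj_conj by auto.
    reflexivity.
  - rewrite !Cpow_inv, Cpow_mult_l by (auto; apply Cmult_neq_0; auto).
    rewrite (Cpow_S ze (S k)). field.
    repeat split; auto; apply Cpow_nz; auto.
Qed.

(** Poisson's formula is Cauchy's formula for f multiplied by a function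
    holomorphic in the closed disk and equal to 1 at z. *)
Lemma poisson_formula (f : C -> C) (rho : R) (z : C) : Cmod z < rho ->
  (forall w, Cmod w <= rho -> Cdiff f w) ->
  is_CInt (fun s => f (rho * turn s)
     * RtoC ((rho ^ 2 - Cmod z ^ 2) / Cmod (rho * turn s - z) ^ 2))%C 0 1 (f z).
Proof.
  intros Hz Hf. assert (Hz0 := Cmod_ge_0 z).
  (* The second factor equals 1 at z, and times the Cauchy kernel it is the
     Poisson kernel on the circle. *)
  set (G := fun w => (f w * (RtoC (rho ^ 2 - Cmod z ^ 2) * / (RtoC (rho * rho) - Cconj z * w)))%C).
  assert (HG : forall w, Cmod w <= rho -> Cdiff G w).
  { intros w Hw. apply Cdiff_mult; [auto|].
    apply (Cdiff_mult (fun _ => RtoC (rho ^ 2 - Cmod z ^ 2))); [apply Cdiff_const|].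
    apply Cdiff_reflected_inv; auto. }
  assert (I := cauchy_formula G rho z Hz HG).
  replace (G z) with (f z) in I.
  2:{ unfold G. rewrite RtoC_minus, Cmod2_conj. replace (rho ^ 2) with (rho * rho) by ring.
      rewrite (Cmult_comm (Cconj z) z). field.
      rewrite Cmult_comm. apply reflected_neq_0; auto. lra. }
  eapply is_CInt_ext; [lra| |exact I]. intros s _. cbv beta.
  assert (N0 : (rho * turn s)%C <> 0%C).
  { apply Cmult_neq_0; [apply RtoC_neq_0; lra|apply turn_neq_0]. }
  assert (N1 : (rho * turn s - z <> 0)%C) by (apply Cminus_eq_contra, circle_neq; auto).
  assert (N2 := Cconj_neq_0 _ N1).
  unfold G. rewrite circle_reflected by lra.
  set (ze := (rho * turn s)%C) in *.
  rewrite RtoC_div, Cmod2_conj.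
  - field. auto.
  - apply pow_nonzero. apply Rgt_not_eq, Cmod_gt_0, N1.
Qed.

Lemma unimodular_rotation (a : C) : exists b : C, Cmod b = 1 /\ (b * a)%C = RtoC (Cmod a).
Proof.
  destruct (Ceq_dec a 0) as [->|H].
  - exists 1%C. rewrite Cmod_1, Cmod_0. split; auto. ring.
  - assert (Hm : Cmod a <> 0) by (apply Rgt_not_eq, Cmod_gt_0, H).
    assert (Hc := RtoC_neq_0 _ Hm).
    exists (Cconj a / Cmod a)%C. split.
    + rewrite Cmod_div, Cmod_conj, Cmod_R, Rabs_pos_eq by (auto using Cmod_ge_0).
      field. auto.
    + replace (Cconj a / Cmod a * a)%C with ((a * Cconj a) / Cmod a)%C by (field; auto).
      rewrite <- Cmod2_conj. simpl pow. rewrite Rmult_1_r, RtoC_mult. field. auto.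
Qed.

(** Caratheodory's argument at an arbitrary point of the disk. After a rotation b
    with b f(z) = |f(z)|, the coefficient is, up to a unimodular factor, the mean of
    2 Re (1 - b f) against the kernel, because the conjugate part and the
    constants have mean 0. The density Re (1 - b f) is nonnegative and the modulus
    of the kernel is at most a multiple of the Poisson kernel, so the coefficient is
    bounded by that multiple of Re (1 - b f(z)) = 1 - |f(z)|. *)
Lemma coefficient_bound_on_circle (f : C -> C) (rho : R) (z : C) (k : nat) : Cmod z < rho ->
  (forall w, Cmod w <= rho -> Cdiff f w) ->
  (forall w, Cmod w <= rho -> Cmod (f w) <= 1) ->
  Cmod (C_derive_n f (S k) z / RtoC (INR (fact (S k))))
    * ((rho ^ 2 - Cmod z ^ 2) * (rho - Cmod z) ^ k) <= 2 * rho * (1 - Cmod (f z)).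
Proof.
  intros Hz Hf HB. assert (Hz0 := Cmod_ge_0 z).
  set (phi := fun s => (f (rho * turn s) * (rho * turn s))%C).
  set (c := cauchy_integral phi rho (S (S k)) z).
  assert (Hon : forall s, Cmod (rho * turn s) <= rho).
  { intros s. rewrite Cmod_circle; lra. }
  replace (C_derive_n f (S k) z / RtoC (INR (fact (S k))))%C with c.
  2:{ rewrite (cauchy_derivatives f 1 rho (S k) z Hz Hf HB). fold phi c.
      field. apply RtoC_neq_0, INR_fact_neq_0. }
  destruct (unimodular_rotation (f z)) as [b [Hb1 Hb2]].
  set (K := fun s => ((rho * turn s) * (/ (rho * turn s - z)) ^ (S (S k)))%C).
  assert (I1 : is_CInt (fun s => f (rho * turn s) * K s)%C 0 1 c).
  { eapply is_CInt_ext; [lra| |apply cauchy_integral_correct; auto].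
    - intros s _. unfold phi, K. cbv beta. ring.
    - intros s _. apply Ccont_mult; [|apply circle_Ccont].
      apply (Ccont_comp f (fun s => rho * turn s)%C); [auto|apply circle_Ccont]. }
  assert (I2 : is_CInt (fun s => Cconj (f (rho * turn s)) * K s)%C 0 1 (RtoC 0))
    by exact (conj_integral_vanishes f rho z k Hz Hf).
  assert (I3 : is_CInt (fun s => Cconj 1 * K s)%C 0 1 (RtoC 0)).
  { apply (conj_integral_vanishes (fun _ => 1%C) rho z k Hz). intros; apply Cdiff_const. }
  (* The integrand is (b f + conj (b f) - 2) K = - 2 Re (1 - b f) K. *)
  assert (I4 := is_CInt_minus _ _ _ _ _ _
    (is_CInt_plus _ _ _ _ _ _ (is_CInt_scal b _ _ _ _ I1) (is_CInt_scal (Cconj b) _ _ _ _ I2))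
    (is_CInt_scal (RtoC 2) _ _ _ _ I3)).
  set (P := fun s => (rho ^ 2 - Cmod z ^ 2) / Cmod (rho * turn s - z) ^ 2).
  assert (I5 : is_RInt (fun s => Re ((1 - b * f (rho * turn s)) * RtoC (P s))%C) 0 1
                 (1 - Cmod (f z))).
  { replace (1 - Cmod (f z)) with (Re (1 - b * f z)%C).
    2:{ rewrite Hb2, <- RtoC_minus. apply re_RtoC. }
    apply is_CInt_Re.
    eapply is_CInt_ext; [lra| |exact (is_CInt_minus _ _ _ _ _ _
       (poisson_formula (fun _ => 1%C) rho z Hz (fun w _ => Cdiff_const 1 w))
       (is_CInt_scal b _ _ _ _ (poisson_formula f rho z Hz Hf)))].
    intros s _. cbv beta. fold (P s). ring. }
  set (D := (rho ^ 2 - Cmod z ^ 2) * (rho - Cmod z) ^ k).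
  assert (D1 : 0 < rho ^ 2 - Cmod z ^ 2) by nra.
  assert (D2 : 0 < (rho - Cmod z) ^ k) by (apply pow_lt; lra).
  assert (D0 : 0 < D) by (apply Rmult_lt_0_compat; auto).
  assert (I6 := is_RInt_scal (V := R_NormedModule) _ _ _ (2 * rho / D) _ I5).
  assert (Main : Cmod c <= 2 * rho / D * (1 - Cmod (f z))).
  { replace (Cmod c) with (Cmod (b * c + Cconj b * 0 - 2 * 0)).
    2:{ replace (b * c + Cconj b * 0 - 2 * 0)%C with (b * c)%C by ring.
        rewrite Cmod_mult, Hb1. ring. }
    rewrite <- Cnorm_Cmod.
    refine (norm_RInt_le (V := C_R_NormedModule) _ _ 0 1 _ _ Rle_0_1 _ I4 I6).
    intros s Hs. rewrite Cnorm_Cmod.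
    set (F := (b * f (rho * turn s))%C).
    assert (HF : Cmod F <= 1).
    { unfold F. rewrite Cmod_mult, Hb1. specialize (HB _ (Hon s)). lra. }
    assert (HR : Re F <= 1).
    { assert (T := re_le_Cmod F). apply Rabs_le_between in T. lra. }
    replace (b * (f (rho * turn s) * K s) + Cconj b * (Cconj (f (rho * turn s)) * K s)
             - 2 * (Cconj 1 * K s))%C with (RtoC (- (2 * (1 - Re F))) * K s)%C.
    2:{ replace (Cconj 1) with (RtoC 1) by (unfold Cconj, RtoC; simpl; rewrite Ropp_0; reflexivity).
        rewrite RtoC_opp, RtoC_mult, RtoC_minus, re_alt. unfold F. rewrite Cmult_conj. field. }
    rewrite Cmod_mult, Cmod_R, Rabs_Ropp, Rabs_pos_eq by lra.
    change (2 * (1 - Re F) * Cmod (K s) <= 2 * rho / D * Re ((1 - F) * RtoC (P s))%C).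
    rewrite re_scal_r. replace (Re (1 - F)%C) with (1 - Re F).
    2:{ unfold Cminus. rewrite re_plus, re_opp, re_RtoC. ring. }
    assert (N1 : (rho * turn s - z <> 0)%C) by (apply Cminus_eq_contra, circle_neq; auto).
    assert (N2 := proj1 (Cmod_gt_0 _) N1).
    unfold K. rewrite Cmod_mult, Cmod_circle, Cmod_pow, Cmod_inv by (auto; lra).
    assert (Hd := circle_dist rho s z ltac:(lra)).
    unfold P, D. set (d := Cmod (rho * turn s - z)) in *.
    replace (2 * rho / ((rho ^ 2 - Cmod z ^ 2) * (rho - Cmod z) ^ k)
             * ((1 - Re F) * ((rho ^ 2 - Cmod z ^ 2) / d ^ 2)))
      with (2 * (1 - Re F) * (rho * (/ (rho - Cmod z) ^ k * / d ^ 2))) by (field; lra).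
    apply Rmult_le_compat_l; [lra|]. apply Rmult_le_compat_l; [lra|].
    rewrite pow_inv. replace (d ^ S (S k)) with (d ^ k * d ^ 2) by (simpl; ring).
    rewrite Rinv_mult. apply Rmult_le_compat_r.
    - left. apply Rinv_0_lt_compat, pow_lt; auto.
    - apply Rinv_le_contravar; auto. apply pow_incr. lra. }
  apply (Rmult_le_compat_r D) in Main; [|lra]. 
  replace (2 * rho / D * (1 - Cmod (f z)) * D) with (2 * rho * (1 - Cmod (f z))) in Main
    by (field; lra).
  exact Main.
Qed.

Lemma positive_near_one (h : R -> R) (r : R) : r < 1 -> ex_derive h 1 -> 0 < h 1 ->
  exists a, r < a < 1 /\ 0 < h a.
Proof.
  intros Hr Hh H1.
  destruct (ex_derive_continuous h 1 Hh (fun y => 0 < y)) as [d Hd].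
  { exists (mkposreal _ H1). intros y Hy.
    change (Rabs (y - h 1) < h 1) in Hy. apply Rabs_lt_between in Hy. lra. }
  set (e := Rmin (d / 2) ((1 - r) / 2)).
  assert (d0 := cond_pos d).
  assert (E1 : e <= d / 2) by apply Rmin_l. assert (E2 : e <= (1 - r) / 2) by apply Rmin_r.
  assert (E0 : 0 < e) by (apply Rmin_pos; lra).
  exists (1 - e). split; [lra|]. apply Hd.
  change (Rabs (1 - e - 1) < d). rewrite Rabs_left; lra.
Qed.

(** The limit rho -> 1. The Schwarz-Pick type estimate of Ruscheweyh has
    1 - |f(z)|^2 in place of 2 (1 - |f(z)|); the weaker form is enough because the
    exponent p is at most 1. *)
Lemma coefficient_bound (f : C -> C) (z : C) (k : nat) :
  analytic_on_disk f -> maps_into_disk f -> Cmod z < 1 ->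
  Cmod (C_derive_n f (S k) z / RtoC (INR (fact (S k))))
    <= 2 * (1 - Cmod (f z)) / ((1 - Cmod z ^ 2) * (1 - Cmod z) ^ k).
Proof.
  intros Hf HB Hz. assert (Hz0 := Cmod_ge_0 z).
  set (x := Cmod (C_derive_n f (S k) z / RtoC (INR (fact (S k))))).
  assert (D : 0 < (1 - Cmod z ^ 2) * (1 - Cmod z) ^ k).
  { apply Rmult_lt_0_compat; [nra|apply pow_lt; lra]. }
  apply (Rmult_le_reg_r _ _ _ D). unfold Rdiv. rewrite Rmult_assoc, Rinv_l, Rmult_1_r by lra.
  apply Rnot_lt_le. intros Hlt.
  destruct (positive_near_one
    (fun rho => x * ((rho ^ 2 - Cmod z ^ 2) * (rho - Cmod z) ^ k) - 2 * rho * (1 - Cmod (f z)))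
    (Cmod z) Hz) as [rho [R1 R2]].
  - auto_derive; auto.
  - rewrite pow1. lra.
  - assert (B := coefficient_bound_on_circle f rho z k (proj1 R1)
      (fun w Hw => Hf w (Rle_lt_trans _ _ _ Hw (proj2 R1)))
      (fun w Hw => Rlt_le _ _ (HB w (Rle_lt_trans _ _ _ Hw (proj2 R1))))).
    fold x in B. lra.
Qed.

(** * The Bohr inequality *)

Lemma ln_le_minus_1 (x : R) : 0 < x -> ln x <= x - 1.
Proof. intros H. assert (E := exp_ineq1_le (ln x)). rewrite exp_ln in E; lra. Qed.

(** For p <= 1 the power function is concave, hence below its tangent at 1. *)
Lemma rpow_le_affine (t p : R) : 0 <= t -> 0 < p <= 1 -> rpow t p <= 1 - p * (1 - t).
Proof.
  intros Ht Hp. unfold rpow. destruct (Req_EM_T t 0) as [->|Hn]; [lra|].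
  assert (t0 : 0 < t) by lra.
  (* Weighted arithmetic-geometric mean inequality for t and 1 with weights p
     and 1 - p: apply ln x <= x - 1 to both numbers divided by their mean m. *)
  set (m := 1 - p * (1 - t)). assert (m0 : 0 < m) by (unfold m; nra).
  unfold Rpower. rewrite <- (exp_ln m) by auto.
  assert (L1 := ln_le_minus_1 (t / m) ltac:(apply Rdiv_lt_0_compat; auto)).
  assert (L2 := ln_le_minus_1 (1 / m) ltac:(apply Rdiv_lt_0_compat; lra)).
  rewrite ln_div in L1, L2 by lra. rewrite ln_1 in L2.
  assert (E : p * (t / m - 1) + (1 - p) * (1 / m - 1) = 0).
  { unfold m. field. unfold m in m0. lra. }
  assert (p * (ln t - ln m) <= p * (t / m - 1)) by (apply Rmult_le_compat_l; lra).
  assert ((1 - p) * (0 - ln m) <= (1 - p) * (1 / m - 1)) by (apply Rmult_le_compat_l; lra).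
  assert (L : p * ln t <= ln m) by lra.
  destruct (Rle_lt_or_eq_dec _ _ L) as [L'|L'].
  - left. apply exp_increasing, L'.
  - right. rewrite L'. reflexivity.
Qed.

(** A lower bound with the same first-order behaviour at 1 as the power itself,
    and rational in t. *)
Lemma rpow_ge_harmonic (t p : R) : 0 < t -> 0 < p -> 1 - p * (1 / t - 1) <= rpow t p.
Proof.
  intros Ht Hp. unfold rpow. destruct (Req_EM_T t 0) as [->|Hn]; [lra|].
  unfold Rpower. eapply Rle_trans; [|apply exp_ineq1_le].
  assert (L := ln_le_minus_1 (1 / t) ltac:(apply Rdiv_lt_0_compat; lra)).
  rewrite ln_div, ln_1 in L by lra.
  assert (p * (0 - ln t) <= p * (1 / t - 1)) by (apply Rmult_le_compat_l; lra). lra.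
Qed.

Lemma bohr_discriminant (lambda p : R) :
  9 * p ^ 2 + 4 * lambda * p + 4 * lambda ^ 2 = (2 * lambda + p) ^ 2 + 8 * p ^ 2.
Proof. ring. Qed.

(** The radius is the positive root of 2 p r^2 + (2 lambda + p) r - p. *)
Lemma le_bohr_radius (lambda p r : R) : 0 < lambda -> 0 < p -> 0 <= r ->
  (r <= bohr_radius lambda p <-> 2 * lambda * r <= p * ((1 + r) * (1 - 2 * r))).
Proof.
  intros Hl Hp Hr. unfold bohr_radius. rewrite bohr_discriminant.
  set (D := (2 * lambda + p) ^ 2 + 8 * p ^ 2).
  assert (D0 : 0 <= D) by (unfold D; nra).
  assert (E : r <= (- 2 * lambda - p + sqrt D) / (4 * p) <-> 4 * p * r + (2 * lambda + p) <= sqrt D).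
  { split; intros H.
    - apply (Rmult_le_compat_r (4 * p)) in H; [|lra].
      unfold Rdiv in H. rewrite Rmult_assoc, Rinv_l in H; lra.
    - apply (Rmult_le_reg_r (4 * p)); [lra|].
      unfold Rdiv. rewrite Rmult_assoc, Rinv_l; lra. }
  assert (P : 0 <= 4 * p * r + (2 * lambda + p)) by nra.
  rewrite E. clear E. split; intros H.
  - assert (S2 : (4 * p * r + (2 * lambda + p)) ^ 2 <= sqrt D ^ 2) by (apply pow_incr; lra).
    rewrite pow2_sqrt in S2 by auto. unfold D in S2. nra.
  - rewrite <- (sqrt_pow2 _ P). apply sqrt_le_1_alt. unfold D. nra.
Qed.

Lemma bohr_radius_ge_0 (lambda p : R) : 0 < lambda -> 0 < p -> 0 <= bohr_radius lambda p.
Proof. intros Hl Hp. apply le_bohr_radius; lra. Qed.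

Lemma bohr_radius_lt_half (lambda p : R) : 0 < lambda -> 0 < p -> bohr_radius lambda p < 1 / 2.
Proof.
  intros Hl Hp. apply Rnot_le_lt. rewrite le_bohr_radius by lra. lra.
Qed.

Lemma geometric_majorant (a : nat -> R) (A q : R) (n : nat) : 0 <= A -> 0 <= q < 1 ->
  (forall k, a k <= A * q ^ k) -> sum_n a n <= A / (1 - q).
Proof.
  intros HA Hq Ha.
  apply Rle_trans with (A / (1 - q) * (1 - q ^ S n)).
  - induction n as [|n IH].
    + rewrite sum_O. specialize (Ha 0%nat). simpl in *.
      replace (A / (1 - q) * (1 - q * 1)) with (A * 1) by (field; lra). auto.
    + rewrite sum_Sn. change (sum_n a n + a (S n) <= A / (1 - q) * (1 - q ^ S (S n))).
      specialize (Ha (S n)).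
      replace (A / (1 - q) * (1 - q ^ S (S n)))
        with (A / (1 - q) * (1 - q ^ S n) + A * q ^ S n) by (simpl; field; lra). lra.
  - assert (0 <= q ^ S n) by (apply pow_le; lra).
    assert (0 <= A / (1 - q)) by (apply Rdiv_le_0_compat; lra). nra.
Qed.

(** Finiteness of the limit lets the extended-real operations in the Bohr sum be
    computed as real ones. *)
Lemma Lim_seq_between (u : nat -> R) (M : R) : (forall n, 0 <= u n <= M) ->
  exists l, Lim_seq u = Finite l /\ 0 <= l <= M.
Proof.
  intros H.
  assert (L1 : Rbar_le (Lim_seq (fun _ => 0)) (Lim_seq u)) by (apply Lim_seq_le_loc; exists 0%nat; intros; apply H).
  assert (L2 : Rbar_le (Lim_seq u) (Lim_seq (fun _ => M))) by (apply Lim_seq_le_loc; exists 0%nat; intros; apply H).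
  rewrite Lim_seq_const in L1, L2.
  destruct (Lim_seq u) as [l| |]; simpl in L1, L2; try contradiction.
  exists l. auto.
Qed.

(** The series is at most 2 (1 - t) r / ((1 + r) (1 - 2 r)) with t = |f(z)| and
    r = |z|; the quadratic inequality for r turns lambda times this into at most
    p (1 - t), the gap left by the tangent bound on the power of t. *)
Lemma bohr_inequality (lambda p : R) (f : C -> C) (z : C) : 0 < lambda -> 0 < p <= 1 ->
  analytic_on_disk f -> maps_into_disk f -> Cmod z <= bohr_radius lambda p ->
  Rbar_le (bohr_sum lambda p f z) (Finite 1).
Proof.
  intros Hl Hp Hf HB Hz. assert (r0 := Cmod_ge_0 z).
  assert (Hhalf := bohr_radius_lt_half lambda p Hl (proj1 Hp)).
  assert (Hrad := proj1 (le_bohr_radius lambda p (Cmod z) Hl (proj1 Hp) r0) Hz).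
  assert (Ht1 := HB z ltac:(lra)). assert (t0 := Cmod_ge_0 (f z)).
  assert (Hco := fun k => coefficient_bound f z k Hf HB ltac:(lra)).
  unfold bohr_sum.
  set (a := fun k => Cmod (C_derive_n f k z / RtoC (INR (fact k))) * Cmod z ^ k).
  set (r := Cmod z) in *. set (t := Cmod (f z)) in *.
  set (M := 2 * (1 - t) * r / ((1 + r) * (1 - 2 * r))).
  destruct (Lim_seq_between (fun n => sum_n (fun k => a (S k)) n) M) as [l [El Hlb]].
  - intros n. split.
    + induction n as [|n IH]; [rewrite sum_O|rewrite sum_Sn; apply Rplus_le_le_0_compat; auto];
      apply Rmult_le_pos; auto using Cmod_ge_0, pow_le.
    +
      (* A geometric series of ratio r / (1 - r), less than 1 as r < 1/2. *)
      replace M with (2 * (1 - t) * r / (1 - r ^ 2) / (1 - r / (1 - r)))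
        by (unfold M; field; repeat split; nra).
      apply geometric_majorant.
      * apply Rdiv_le_0_compat; nra.
      * split; [apply Rdiv_le_0_compat; lra|].
        apply (Rmult_lt_reg_r (1 - r)); [lra|].
        unfold Rdiv. rewrite Rmult_assoc, Rinv_l; lra.
      * intros k. unfold a.
        apply Rle_trans with (2 * (1 - t) / ((1 - r ^ 2) * (1 - r) ^ k) * r ^ S k).
        -- apply Rmult_le_compat_r; [apply pow_le; auto|apply Hco].
        -- right. unfold Rdiv. rewrite Rpow_mult_distr, pow_inv. simpl. field.
           split; [apply pow_nonzero; lra|nra].
  - change (Series1_bar _) with (Lim_seq (fun n => sum_n (fun k => a (S k)) n)).
    rewrite El. simpl.
    assert (P := rpow_le_affine t p t0 Hp).
    assert (lambda * l <= p * (1 - t)).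
    { apply Rle_trans with (lambda * M); [apply Rmult_le_compat_l; lra|].
      assert (D : 0 < (1 + r) * (1 - 2 * r)) by nra.
      apply (Rmult_le_reg_r _ _ _ D).
      replace (lambda * M * ((1 + r) * (1 - 2 * r))) with (2 * lambda * r * (1 - t))
        by (unfold M; field; lra).
      replace (p * (1 - t) * ((1 + r) * (1 - 2 * r))) with (p * ((1 + r) * (1 - 2 * r)) * (1 - t)) by ring.
      apply Rmult_le_compat_r; lra. }
    lra.
Qed.

(** * Sharpness: Blaschke factors *)

Definition blaschke (a : R) (w : C) : C := ((a - w) / (1 - a * w))%C.

Lemma blaschke_denominator (a : R) (w : C) : 0 < a < 1 -> Cmod w < 1 -> (1 - a * w)%C <> 0%C.
Proof.
  intros Ha Hw. apply Cminus_eq_contra. intros E. apply (f_equal Cmod) in E.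
  rewrite Cmod_1, Cmod_mult, Cmod_R, Rabs_pos_eq in E by lra.
  assert (H := Cmod_ge_0 w). nra.
Qed.

(** The difference |1 - a w|^2 - |a - w|^2 equals (1 - a^2) (1 - |w|^2). *)
Lemma blaschke_maps_into_disk (a : R) : 0 < a < 1 -> maps_into_disk (blaschke a).
Proof.
  intros Ha w Hw. assert (N := blaschke_denominator a w Ha Hw).
  assert (N' := proj1 (Cmod_gt_0 _) N). assert (H := Cmod_ge_0 w).
  unfold blaschke. rewrite Cmod_div by auto.
  apply (Rmult_lt_reg_r _ _ _ N'). unfold Rdiv. rewrite Rmult_assoc, Rinv_l by lra.
  rewrite Rmult_1_r, Rmult_1_l.
  apply Rsqr_incrst_0; auto using Cmod_ge_0. rewrite !Rsqr_pow2, !Cmod2_alt.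
  assert (W := Cmod2_alt w).
  destruct w as [x y]. unfold Re, Im, Cminus, Cplus, Copp, Cmult, RtoC in *. simpl fst in *. simpl snd in *.
  assert (0 < (1 - a * a) * (1 - Cmod (x, y) ^ 2)) by (apply Rmult_lt_0_compat; nra).
  nra.
Qed.

Lemma blaschke_kernel_deriv (a : R) (w : C) : (1 - a * w)%C <> 0%C ->
  Cderiv (fun w => / (1 - a * w))%C w (a * (/ (1 - a * w)) ^ 2)%C.
Proof.
  intros N.
  replace (a * (/ (1 - a * w)) ^ 2)%C with (- a * - / ((1 - a * w) * (1 - a * w)))%C
    by (simpl; field; auto).
  apply (Cderiv_comp (fun v => / v)%C (fun w => 1 - a * w)%C); [apply Cderiv_inv, N|].
  apply (Cderiv_ext_loc (fun w => 1 + (- a) * w)%C _ _ _ 1 Rlt_0_1); [|apply Cderiv_affine].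
  intros v _. ring.
Qed.

Lemma blaschke_kernel_pow_deriv (a : R) (m : nat) (w : C) : (1 - a * w)%C <> 0%C ->
  Cderiv (fun w => (/ (1 - a * w)) ^ m)%C w (RtoC (INR m) * a * (/ (1 - a * w)) ^ S m)%C.
Proof.
  intros N. induction m as [|m IH].
  - simpl. replace (0 * a * (/ (1 - a * w) * 1))%C with (RtoC 0) by ring. apply Cderiv_const.
  - apply (Cderiv_ext_loc (fun w => / (1 - a * w) * (/ (1 - a * w)) ^ m)%C _ _ _ 1 Rlt_0_1).
    + intros v _. rewrite Cpow_S. reflexivity.
    + replace (RtoC (INR (S m)) * a * (/ (1 - a * w)) ^ S (S m))%C with
        (a * (/ (1 - a * w)) ^ 2 * (/ (1 - a * w)) ^ m
         + / (1 - a * w) * (RtoC (INR m) * a * (/ (1 - a * w)) ^ S m))%C.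
      * exact (Cderiv_mult _ _ _ _ _ (blaschke_kernel_deriv a w N) IH).
      * rewrite S_INR, RtoC_plus, !Cpow_S. simpl Cpow. ring.
Qed.

Lemma blaschke_deriv (a : R) (w : C) : (1 - a * w)%C <> 0%C ->
  Cderiv (blaschke a) w ((- (1 - a * a)) * (/ (1 - a * w)) ^ 2)%C.
Proof.
  intros N.
  replace (- (1 - a * a) * (/ (1 - a * w)) ^ 2)%C with
    (- (1) * / (1 - a * w) + (a - w) * (a * (/ (1 - a * w)) ^ 2))%C by (simpl; field; auto).
  apply (Cderiv_mult (fun w => a - w)%C (fun w => / (1 - a * w))%C).
  - apply (Cderiv_ext_loc (fun w => a + (- (1)) * w)%C _ _ _ 1 Rlt_0_1); [|apply Cderiv_affine].
    intros v _. ring.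
  - apply blaschke_kernel_deriv, N.
Qed.

Lemma blaschke_derivatives (a : R) (k : nat) : 0 < a < 1 -> forall w, Cmod w < 1 ->
  C_derive_n (blaschke a) (S k) w
  = (RtoC (- ((1 - a * a) * INR (fact (S k)) * a ^ k)) * (/ (1 - a * w)) ^ S (S k))%C.
Proof.
  intros Ha. induction k as [|k IH]; intros w Hw; assert (N := blaschke_denominator a w Ha Hw).
  - simpl C_derive_n. apply is_C_derive_unique.
    replace (RtoC (- ((1 - a * a) * INR (fact 1) * a ^ 0))) with (- (1 - a * a))%C.
    + apply blaschke_deriv, N.
    + simpl. rewrite !Rmult_1_r, RtoC_opp, RtoC_minus, RtoC_mult. reflexivity.
  - change (C_derive_n (blaschke a) (S (S k)) w)
      with (C_derive (C_derive_n (blaschke a) (S k)) w).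
    apply is_C_derive_unique.
    set (A := RtoC (- ((1 - a * a) * INR (fact (S k)) * a ^ k))) in *.
    apply (Cderiv_ext_loc (fun w => A * (/ (1 - a * w)) ^ S (S k))%C _ _ _ (1 - Cmod w)).
    + lra.
    + intros v Hv. symmetry. apply IH.
      assert (T := Cmod_triangle w (v - w)). replace (w + (v - w))%C with v in T by ring. lra.
    + replace (RtoC (- ((1 - a * a) * INR (fact (S (S k))) * a ^ S k)) * (/ (1 - a * w)) ^ S (S (S k)))%C
        with (0 * (/ (1 - a * w)) ^ S (S k)
              + A * (RtoC (INR (S (S k))) * a * (/ (1 - a * w)) ^ S (S (S k))))%C.
      * apply (Cderiv_mult (fun _ => A)); [apply Cderiv_const|apply blaschke_kernel_pow_deriv, N].
      * unfold A. rewrite (fact_simpl (S k)), mult_INR.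
        replace (- ((1 - a * a) * (INR (S (S k)) * INR (fact (S k))) * a ^ S k))
          with (- ((1 - a * a) * INR (fact (S k)) * a ^ k) * INR (S (S k)) * a) by (simpl pow; ring).
        rewrite !(RtoC_mult _ a), !(RtoC_mult _ (INR (S (S k)))). ring.
Qed.

Lemma blaschke_term (a r : R) (k : nat) : 0 < a < 1 -> 0 < r < 1 ->
  Cmod (C_derive_n (blaschke a) (S k) r / RtoC (INR (fact (S k)))) * Cmod r ^ S k
  = (1 - a ^ 2) * r / (1 - a * r) ^ 2 * (a * r / (1 - a * r)) ^ k.
Proof.
  intros Ha Hr. assert (H : a * r < 1) by nra.
  assert (Hf := INR_fact_lt_0 (S k)).
  rewrite blaschke_derivatives by (auto; rewrite Cmod_R, Rabs_pos_eq; lra).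
  assert (N : (1 - a * r)%C <> 0%C).
  { apply blaschke_denominator; auto. rewrite Cmod_R, Rabs_pos_eq; lra. }
  rewrite Cmod_div by (apply RtoC_neq_0; lra).
  rewrite Cmod_mult, Cmod_pow, Cmod_inv by auto.
  rewrite <- RtoC_mult, <- RtoC_minus, !Cmod_R, Rabs_Ropp.
  assert (0 < a ^ k) by (apply pow_lt; lra).
  rewrite !Rabs_pos_eq; try lra.
  2:{ repeat apply Rmult_le_pos; nra. }
  unfold Rdiv. rewrite !Rpow_mult_distr, !pow_inv. simpl pow. field.
  repeat split; try lra. apply pow_nonzero; lra.
Qed.

(** At a real point r of (0, 1/2) the moduli of the Taylor terms form a geometric
    series of ratio a r / (1 - a r) < 1. *)
Lemma blaschke_series (a r : R) : 0 < a < 1 -> 0 < r < 1 / 2 ->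
  Series1_bar (fun k => Cmod (C_derive_n (blaschke a) k r / RtoC (INR (fact k))) * Cmod r ^ k)
  = Finite ((1 - a ^ 2) * r / ((1 - a * r) * (1 - 2 * a * r))).
Proof.
  intros Ha Hr. assert (H : 0 < 2 * a * r < 1) by nra.
  apply is_lim_seq_unique.
  apply is_lim_seq_ext with (sum_n (fun k => (1 - a ^ 2) * r / (1 - a * r) ^ 2 * (a * r / (1 - a * r)) ^ k)).
  { intros n. apply sum_n_ext. intros k. symmetry. apply blaschke_term; lra. }
  assert (G := is_series_geom (a * r / (1 - a * r))).
  assert (Q : Rabs (a * r / (1 - a * r)) < 1).
  { rewrite Rabs_pos_eq by (apply Rdiv_le_0_compat; lra).
    apply (Rmult_lt_reg_r (1 - a * r)); [lra|]. unfold Rdiv. rewrite Rmult_assoc, Rinv_l; lra. }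
  specialize (G Q).
  apply (is_series_scal_l ((1 - a ^ 2) * r / (1 - a * r) ^ 2)) in G.
  replace ((1 - a ^ 2) * r / ((1 - a * r) * (1 - 2 * a * r)))
    with ((1 - a ^ 2) * r / (1 - a * r) ^ 2 * / (1 - a * r / (1 - a * r))).
  - exact G.
  - field. repeat split; lra.
Qed.

(** At r just above the radius, let a tend to 1 in the Blaschke factor. Both the
    defect 1 - |f(r)|^p and the series vanish to first order in 1 - a, and the leading
    term of lambda times the series is the larger one precisely because r violates the quadratic
    inequality of le_bohr_radius. *)
Lemma bohr_radius_sharp (lambda p R' : R) : 0 < lambda -> 0 < p -> bohr_radius lambda p < R' < 1 ->
  exists f : C -> C, analytic_on_disk f /\ maps_into_disk f /\
    exists z : C, Cmod z <= R' /\ ~ Rbar_le (bohr_sum lambda p f z) (Finite 1).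
Proof.
  intros Hl Hp HR.
  assert (Hhalf := bohr_radius_lt_half lambda p Hl Hp).
  assert (Hpos := bohr_radius_ge_0 lambda p Hl Hp).
  set (r := (bohr_radius lambda p + Rmin R' (1 / 2)) / 2).
  assert (M1 := Rmin_l R' (1 / 2)). assert (M2 := Rmin_r R' (1 / 2)).
  assert (M3 : bohr_radius lambda p < Rmin R' (1 / 2)) by (apply Rmin_glb_lt; lra).
  assert (Hr : bohr_radius lambda p < r < Rmin R' (1 / 2)) by (unfold r; lra).
  assert (Hgap : p * ((1 + r) * (1 - 2 * r)) < 2 * lambda * r).
  { apply Rnot_le_lt. rewrite <- le_bohr_radius; lra. }
  (* Times (1 - a) and a positive factor, the polynomial is the lower bound for
     the excess of the Bohr sum over 1 that rpow_ge_harmonic gives. *)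
  destruct (positive_near_one
    (fun a => lambda * (1 + a) * r * (a - r) - p * (1 + r) * (1 - a * r) * (1 - 2 * a * r)) r)
    as [a [Ha Hineq]].
  - lra.
  - auto_derive; auto.
  - replace (lambda * (1 + 1) * r * (1 - r) - p * (1 + r) * (1 - 1 * r) * (1 - 2 * 1 * r))
      with ((2 * lambda * r - p * ((1 + r) * (1 - 2 * r))) * (1 - r)) by ring.
    apply Rmult_lt_0_compat; lra.
  - assert (Ha' : 0 < a < 1) by lra.
    exists (blaschke a). repeat split.
    + intros w Hw. eexists. apply blaschke_deriv, blaschke_denominator; auto.
    + apply blaschke_maps_into_disk; auto.
    + exists (RtoC r). split; [rewrite Cmod_R, Rabs_pos_eq; lra|].
      unfold bohr_sum. rewrite blaschke_series by lra.
      assert (H : 0 < 2 * a * r < 1) by nra.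
      replace (Cmod (blaschke a r)) with ((a - r) / (1 - a * r)).
      2:{ unfold blaschke. rewrite <- RtoC_mult, <- !RtoC_minus, <- RtoC_div by lra.
          rewrite Cmod_R, Rabs_pos_eq; auto. apply Rdiv_le_0_compat; lra. }
      simpl. apply Rlt_not_le.
      eapply Rlt_le_trans; [|apply Rplus_le_compat_r, rpow_ge_harmonic; auto; apply Rdiv_lt_0_compat; lra].
      assert (D : 0 < (a - r) * ((1 - a * r) * (1 - 2 * a * r))) by (repeat apply Rmult_lt_0_compat; lra).
      apply Rminus_lt_0.
      replace (1 - p * (1 / ((a - r) / (1 - a * r)) - 1)
         + lambda * ((1 - a * (a * 1)) * r / ((1 - a * r) * (1 - 2 * a * r))) - 1)
        with ((1 - a) * (lambda * (1 + a) * r * (a - r) - p * (1 + r) * (1 - a * r) * (1 - 2 * a * r))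
              / ((a - r) * ((1 - a * r) * (1 - 2 * a * r)))) by (field; lra).
      apply Rdiv_lt_0_compat; auto. apply Rmult_lt_0_compat; lra.
Qed.

Theorem theorem3p2 (lambda p : R) (hlambda : 0 < lambda) (hp : 0 < p <= 1) :
  bohr_radius lambda p < 1 / 2 /\
  (forall f : C -> C, analytic_on_disk f -> maps_into_disk f ->
     forall z : C, Cmod z <= bohr_radius lambda p ->
       Rbar_le (bohr_sum lambda p f z) (Finite 1)) /\
  (forall R' : R, bohr_radius lambda p < R' < 1 ->
     exists f : C -> C, analytic_on_disk f /\ maps_into_disk f /\
       exists z : C, Cmod z <= R' /\
         ~ Rbar_le (bohr_sum lambda p f z) (Finite 1)).
Proof.
  repeat split.
  - apply bohr_radius_lt_half; tauto.
  - intros f Hf HB z Hz. apply bohr_inequality; auto.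
  - intros R' HR. apply bohr_radius_sharp; tauto.
Qed.
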